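(* Let $N\ge 2$, $\alpha\in(0,1)$, $\lambda>0$, and let $p$ satisfy $$1+2\alpha<p<\frac{1+\alpha}{1-\alpha}.$$ Suppose $u\in C^{2\alpha+\beta}_{loc}(\mathbb{R}^N)\cap L^1(\mathbb{R}^N,\omega)$ for some $\beta>0$, where $\omega(y)=1/(1+|y|^{N+2\alpha})$, is a nonnegative solution of $$(-\Delta)^\alpha u=\lambda u-u^p\quad\text{in }\mathbb{R}^N.$$ Then $u$ must be a constant.
   Context: The fractional Laplacian is defined (up to a normalization constant) by $(-\Delta)^\alpha u(x)=\int_{\mathbb{R}^N}\frac{2u(x)-u(x+y)-u(x-y)}{|y|^{N+2\alpha}}\,dy$ for $x\in\mathbb{R}^N$. $L^1(\mathbb{R}^N,\omega)$ denotes the space of functions $u$ with $\int_{\mathbb{R}^N}|u(y)|\omega(y)\,dy<\infty$. *)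

(* Defs.v *)
From HB Require Import structures.
From mathcomp Require Import all_boot all_order all_algebra.
From mathcomp Require Import all_classical all_reals all_analysis.
Set Implicit Arguments. Unset Strict Implicit. Unset Printing Implicit Defensive.
Import Order.TTheory GRing.Theory Num.Theory.
Import numFieldNormedType.Exports.
Local Open Scope classical_set_scope.
Local Open Scope ring_scope.

Section Defs.
Variable R : realType.

(* Euclidean norm on R^N = 'rV[R]_N (the library's norm on matrices is the sup norm). *)
Definition enorm (N : nat) (y : 'rV[R]_N) : R := Num.sqrt (\sum_(i < N) y ord0 i ^+ 2).

(* Iterated Lebesgue integral on R^n of an extended-real function of the
   coordinates (x_0, ..., x_{n-1}); coordinates are encoded as nat -> R.
   iint (m+1) f = \int dt iint m (f with coordinate m set to t).
   For nonnegative measurable integrands this is the Lebesgue integral on R^n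
   (Tonelli). *)
Fixpoint iint (n : nat) (f : (nat -> R) -> \bar R) : \bar R :=
  match n with
  | 0 => f (fun _ => 0)
  | m.+1 => (\int[@lebesgue_measure R]_t
               iint m (fun x => f (fun k => if k == m then t else x k)))%E
  end.

Definition vec_of (N : nat) (x : nat -> R) : 'rV[R]_N := \row_(i < N) x i.

Definition intRN_nng (N : nat) (g : 'rV[R]_N -> \bar R) : \bar R :=
  iint N (fun x => g (vec_of N x)).

(* g is Lebesgue integrable on R^N (Borel measurable, via the product sigma-algebra
   on N.-tuple R, and with finite integral of |g|). *)
Definition integrableRN (N : nat) (g : 'rV[R]_N -> R) : Prop :=
  measurable_fun [set: N.-tuple R] (fun t => g (\row_(i < N) tnth t i)) /\
  (intRN_nng (fun y => (`|g y|)%:E) < +oo)%E.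

Definition intRN (N : nat) (g : 'rV[R]_N -> R) : \bar R :=
  (intRN_nng (fun y => (Num.max (g y) 0)%:E) -
   intRN_nng (fun y => (Num.max (- g y) 0)%:E))%E.

(* The fractional Laplacian (without normalization constant), as in the paper:
   (-Delta)^a u(x) = \int (2u(x) - u(x+y) - u(x-y)) / |y|^(N+2a) dy. *)
Definition fraclap_integrand (N : nat) (a : R) (u : 'rV[R]_N -> R)
  (x : 'rV[R]_N) : 'rV[R]_N -> R :=
  fun y => (2 * u x - u (x + y) - u (x - y)) / (enorm y `^ (N%:R + 2 * a)).

Definition omega (N : nat) (a : R) (y : 'rV[R]_N) : R :=
  1 / (1 + enorm y `^ (N%:R + 2 * a)).

Definition L1_omega (N : nat) (a : R) (u : 'rV[R]_N -> R) : Prop :=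
  integrableRN (fun y => `|u y| * omega a y).

Definition pderiv (N : nat) (i : 'I_N) (f : 'rV[R]_N -> R) : 'rV[R]_N -> R :=
  fun x => 'D_(delta_mx ord0 i) f x.

Fixpoint Ck (N : nat) (k : nat) (f : 'rV[R]_N -> R) : Prop :=
  match k with
  | 0 => continuous f
  | k'.+1 => continuous f /\
      forall i : 'I_N, (forall x, derivable f x (delta_mx ord0 i)) /\
                       Ck k' (pderiv i f)
  end.

Fixpoint all_derivs (N : nat) (k : nat) (f : 'rV[R]_N -> R)
  (P : ('rV[R]_N -> R) -> Prop) : Prop :=
  match k with
  | 0 => P f
  | k'.+1 => forall i : 'I_N, all_derivs k' (pderiv i f) P
  end.

Definition loc_holder (N : nat) (gam : R) (g : 'rV[R]_N -> R) : Prop :=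
  forall r : R, 0 < r -> exists C : R, forall x y : 'rV[R]_N,
    enorm x <= r -> enorm y <= r -> `|g x - g y| <= C * enorm (x - y) `^ gam.

Definition Cloc (N : nat) (s : R) (u : 'rV[R]_N -> R) : Prop :=
  exists (k : nat) (gam : R), 0 < gam /\ gam <= 1 /\ s = k%:R + gam /\
    Ck k u /\ all_derivs k u (loc_holder gam).

End Defs.

(* Main.v *)
(* The solution is compared with powers of the parabolic cap
   b(x) = (r^2 - |x - x0|^2)_+, whose second differences at a point with b > 0 are
   controlled by |y|^2 alone (parallelogram identity); Bernoulli's inequality then
   handles b^n.
   Boundedness: at a maximum x1 of u b^n on the ball of radius r = 1 + |x0|, the near
   part of the integral is O(s^-2) u(x1) with s = b(x1)/r^2, and the far part is
   O(s^-(N+2 alpha)) times the weighted L^1 norm of u; as n is large the equation gives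
   k^p <= a k + c for k = u(x1) s^n >= u(x0), with a and c independent of x0.
   Upper bound u^(p-1) <= lambda: perturb an almost maximal value of u by a small cap.
   Lower bound u^(p-1) >= lambda when u is not identically 0: at a minimum x1 of u/b^n,
   (-Delta)^alpha u(x1) <= o(1) u(x1) if b(x1) is large. If b(x1) stays bounded while
   r -> oo, the nonlocal contribution of the mass of u near x0, of order
   r^-(N+2 alpha), forces u(x1) >= c r^-(N+2 alpha) b(x1), whence
   u(x0) >= u(x1) r^(2n) / b(x1)^n is unbounded, a contradiction. *)

Require Import Defs.
From HB Require Import structures.
From mathcomp Require Import all_boot all_order all_algebra.
From mathcomp Require Import all_classical all_reals all_analysis.
From mathcomp Require Import measurable_realfun ring lra.
Import Order.TTheory GRing.Theory Num.Theory.
Import numFieldNormedType.Exports.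
Local Open Scope classical_set_scope.
Local Open Scope ring_scope.

Set Implicit Arguments.
Unset Strict Implicit.
Unset Printing Implicit Defensive.

(** * Iterated integrals *)

(** A nonnegative integral is a supremum over simple functions below the integrand, so monotonicity
    needs no measurability. This lets signed integrands be compared with explicit majorants. *)
Lemma ge0_le_integral_nomeas d (T : measurableType d) (R : realType)
    (mu : {measure set T -> \bar R}) (f g : T -> \bar R) :
  (forall x, 0 <= f x)%E -> (forall x, f x <= g x)%E ->
  (\int[mu]_x f x <= \int[mu]_x g x)%E.
Proof.
move=> f0 fg; have g0 x : (0 <= g x)%E by exact: le_trans (fg x).
rewrite !ge0_integralTE//; apply: le_ereal_sup => _ [h hf <-].
by exists h => // x; exact: le_trans (fg x).
Qed.

(** * Translations and reflections of the line *)

Section affine_line.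
Variable R : realType.
Local Notation mu := (@lebesgue_measure R).
Variables (a s : R).
Hypothesis hs : s = 1 \/ s = -1.
Let phi : measurableTypeR R -> measurableTypeR R := fun t => a + s * t.

Let mphi : measurable_fun setT phi.
Proof. by apply: measurable_funD => //; exact: measurable_funM. Qed.

HB.instance Definition _ := isMeasurableFun.Build _ _ _ _ phi mphi.

Let lebesgue_measure_affine (A : set (measurableTypeR R)) : measurable A ->
  mu A = pushforward mu phi A.
Proof.
apply: lebesgue_measure_unique => _ [[c d]] _ <-; rewrite /pushforward.
case: hs => hs1.
  transitivity (mu `]c - a, d - a]%classic).
    by rewrite !lebesgue_measure_itv/= !lte_fin ltrD2r -!EFinB; case: ifP => // _;
      congr EFin; ring.
  congr (mu _); apply/seteqP; split=> x /=;
    rewrite /phi !in_itv /= hs1 mul1r => /andP[? ?]; apply/andP; split; lra.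
(* A reflection exchanges the closed and the open end of the interval; its length is unchanged. *)
transitivity (mu `[a - d, a - c[%classic).
  rewrite !lebesgue_measure_itv/= !lte_fin ltrD2l ltrN2 -!EFinB; case: ifP => // _.
  by congr EFin; ring.
congr (mu _); apply/seteqP; split=> x /=;
  rewrite /phi !in_itv /= hs1 mulN1r => /andP[? ?]; apply/andP; split; lra.
Qed.

Lemma ge0_integral_affine (f : R -> \bar R) :
  measurable_fun setT f -> (forall t, 0 <= f t)%E ->
  (\int[mu]_t f (a + s * t)%R = \int[mu]_t f t)%E.
Proof.
move=> mf f0.
transitivity (\int[pushforward mu phi]_t f t)%E.
  by rewrite ge0_integral_pushforward// preimage_setT.
by apply: eq_measure_integral => A mA _; exact/esym/lebesgue_measure_affine.
Qed.

End affine_line.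

(** * Tonelli calculus for iterated integrals *)

Section iterated_integral.
Variable R : realType.
Local Notation mu := (@lebesgue_measure R).
Implicit Types (f g : (nat -> R) -> \bar R) (x : nat -> R).

Definition upd x (n : nat) (t : R) : nat -> R := fun k => if k == n then t else x k.

(* The space [nat -> R] carries no sigma-algebra in the library; testing against
   coordinatewise measurable maps is stable under all operations of [iint]. *)
Definition coord_measurable f := forall d (T : measurableType d)
  (phi : T -> nat -> R), (forall i, measurable_fun setT (phi ^~ i)) ->
  measurable_fun setT (fun t => f (phi t)).

Lemma measurable_upd d (T : measurableType d) (phi : T -> nat -> R) n
    (psi : T -> R) :
  (forall i, measurable_fun setT (phi ^~ i)) -> measurable_fun setT psi ->
  forall i, measurable_fun setT (fun t => upd (phi t) n (psi t) i).
Proof. by move=> mphi mpsi i; rewrite /upd; case: (i == n). Qed.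

Lemma iint_ge0 n f : (forall x, 0 <= f x)%E -> (0 <= iint n f)%E.
Proof.
elim: n f => [|n IH] f f0 //=; apply: integral_ge0 => t _; exact: IH.
Qed.

Lemma le_iint n f g : (forall x, 0 <= f x)%E -> (forall x, f x <= g x)%E ->
  (iint n f <= iint n g)%E.
Proof.
elim: n f g => [|n IH] f g f0 fg //=.
apply: ge0_le_integral_nomeas => t; [exact: iint_ge0|exact: IH].
Qed.

(** The parameter space is arbitrary so that the induction can adjoin the outermost integration
    variable to it; Tonelli then integrates that variable out. *)
Lemma measurable_iint_param n d (T : measurableType d)
    (F : T -> (nat -> R) -> \bar R) :
  (forall t x, 0 <= F t x)%E ->
  (forall d' (T' : measurableType d') (a : T' -> T) (phi : T' -> nat -> R),
    measurable_fun setT a -> (forall i, measurable_fun setT (phi ^~ i)) ->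
    measurable_fun setT (fun t => F (a t) (phi t))) ->
  measurable_fun setT (fun t => iint n (F t)).
Proof.
elim: n d T F => [|n IH] d T F F0 mF /=.
  by apply: (mF _ _ idfun (fun _ _ => 0)) => //; exact: measurable_id.
pose G (z : T * measurableTypeR R) := iint n (fun x => F z.1 (upd x n z.2)).
have mG : measurable_fun setT G.
  apply: IH => // d' T' a phi ma mphi.
  apply: (mF _ _ (fst \o a) (fun t => upd (phi t) n (a t).2)).
    exact: measurableT_comp.
  apply: measurable_upd => //.
  exact: (measurableT_comp (f := snd)).
apply: (measurable_fun_fubini_tonelli_F (m2 := mu) G mG).
by move=> z; exact: iint_ge0.
Qed.

Lemma coord_measurable_upd n t f :
  coord_measurable f -> coord_measurable (fun x => f (upd x n t)).
Proof. by move=> mf d T phi mphi; apply: mf; exact: measurable_upd. Qed.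

Lemma measurable_iint_upd n f :
  coord_measurable f -> (forall x, 0 <= f x)%E ->
  measurable_fun setT (fun t : measurableTypeR R => iint n (fun x => f (upd x n t))).
Proof.
move=> mf f0; apply: measurable_iint_param => // d' T' a phi ma mphi.
by apply: (mf _ _ (fun t => upd (phi t) n (a t))); exact: measurable_upd.
Qed.

Lemma iintD n f g : coord_measurable f -> coord_measurable g ->
  (forall x, 0 <= f x)%E -> (forall x, 0 <= g x)%E ->
  (iint n (fun x => f x + g x) = iint n f + iint n g)%E.
Proof.
elim: n f g => [//|n IH] f g mf mg f0 g0 /=.
rewrite -ge0_integralD//.
- by apply: eq_integral => t _; apply: IH => //; exact: coord_measurable_upd.
- by move=> t _; exact: iint_ge0.
- exact: measurable_iint_upd.
- by move=> t _; exact: iint_ge0.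
- exact: measurable_iint_upd.
Qed.

Lemma iintZr n f (c : \bar R) : coord_measurable f -> (forall x, 0 <= f x)%E ->
  (0 <= c)%E -> (iint n (fun x => f x * c) = iint n f * c)%E.
Proof.
elim: n f => [//|n IH] f mf f0 c0 /=.
rewrite -ge0_integralZr//.
- by apply: eq_integral => t _; apply: IH => //; exact: coord_measurable_upd.
- exact: measurable_iint_upd.
- by move=> t _; exact: iint_ge0.
Qed.

(** The one-dimensional invariance is applied to one coordinate at a time, outermost first.
    Coordinates from [n] on are not integrated and stay fixed. *)
Lemma iint_affine n (a : nat -> R) (s : R) f : s = 1 \/ s = -1 ->
  coord_measurable f -> (forall x, 0 <= f x)%E ->
  iint n (fun x => f (fun k => if (k < n)%N then a k + s * x k else x k)) =
  iint n f.
Proof.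
move=> hs; elim: n f => [//|n IH] f mf f0 /=.
rewrite -(@ge0_integral_affine _ (a n) s hs
  (fun t => iint n (fun x => f (upd x n t)))).
- apply: eq_integral => t _.
  rewrite -(IH (fun x => f (upd x n (a n + s * t)))) //.
    congr iint; apply/funext => x; congr f; apply/funext => k.
    rewrite /upd ltnS leq_eqVlt; case: eqP => [->|] //=.
  exact: coord_measurable_upd.
- exact: measurable_iint_upd.
- by move=> t; exact: iint_ge0.
Qed.

Lemma coord_measurable_prod n (h : nat -> R -> \bar R) :
  (forall i, measurable_fun setT (h i)) ->
  coord_measurable (fun x => \prod_(i < n) h i (x i))%E.
Proof.
move=> mh d T phi mphi; elim: n => [|n IH].
  by under eq_fun do rewrite big_ord0; exact: measurable_cst.
under eq_fun do rewrite big_ord_recr /=.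
apply: emeasurable_funM => //.
exact: (measurableT_comp (mh n) (mphi n)).
Qed.

Lemma iint_prod n (h : nat -> R -> \bar R) :
  (forall i, measurable_fun setT (h i)) -> (forall i t, 0 <= h i t)%E ->
  iint n (fun x => \prod_(i < n) h i (x i))%E =
  (\prod_(i < n) \int[mu]_t h i t)%E.
Proof.
move=> mh h0; have prod0 m x : (0 <= \prod_(i < m) h i (x i))%E.
  by apply: prode_ge0 => i _.
elim: n => [|n IH]; first by rewrite /= !big_ord0.
rewrite big_ord_recr -IH /= -ge0_integralZl//; [|exact: mh|by apply: iint_ge0 => x; exact: prod0].
apply: eq_integral => t _; rewrite -iintZr//.
- congr iint; apply/funext => x; rewrite big_ord_recr /= eqxx; congr (_ * _)%E.
  by apply: eq_bigr => i _; rewrite ltn_eqF.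
- exact: coord_measurable_prod.
- by move=> x; exact: prod0.
Qed.

Variable N : nat.
Implicit Type F : 'rV[R]_N -> \bar R.

Definition vec_measurable F := coord_measurable (fun x => F (vec_of N x)).

(** Bridge from the product sigma-algebra of [integrableRN]: a map into tuples is measurable as soon
    as its coordinates are. *)
Lemma vec_measurable_tuple F :
  measurable_fun [set: N.-tuple R] (fun t => F (\row_(i < N) tnth t i)) ->
  vec_measurable F.
Proof.
move=> mF d T phi mphi.
have -> : (fun t => F (vec_of N (phi t))) =
    (fun t => F (\row_(i < N) tnth t i)) \o (fun t => [tuple phi t i | i < N]).
  apply/funext => t /=; congr F; apply/rowP => i.
  by rewrite !mxE tnth_mktuple.
apply: measurableT_comp => //; apply/measurable_fun_tnthP => i.
have -> : (@tnth N R ^~ i) \o (fun t => [tuple phi t i0 | i0 < N]) = phi ^~ i.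
  by apply/funext => t /=; rewrite tnth_mktuple.
exact: mphi.
Qed.

(** Padding by zero turns a vector into the [nat]-indexed coordinates on which [iint] works. *)
Let coef (a : 'rV[R]_N) k : R := if insub k is Some i then a ord0 i else 0.

Let affine_coord (a : 'rV[R]_N) (s : R) x : nat -> R :=
  fun k => if (k < N)%N then coef a k + s * x k else x k.

Let vec_of_affine (a : 'rV[R]_N) (s : R) x :
  vec_of N (affine_coord a s x) = a + s *: vec_of N x.
Proof. by apply/rowP => i; rewrite !mxE /affine_coord /coef ltn_ord valK. Qed.

Lemma vec_measurable_affine F (a : 'rV[R]_N) (s : R) :
  vec_measurable F -> vec_measurable (fun y => F (a + s *: y)).
Proof.
move=> mF d T phi mphi; under eq_fun do rewrite -vec_of_affine.
apply: (mF _ _ (fun t => affine_coord a s (phi t))) => i; rewrite /affine_coord.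
case: (i < N)%N => //; apply: measurable_funD => //; exact: measurable_funM.
Qed.

Lemma vec_measurableD F G : vec_measurable F -> vec_measurable G ->
  vec_measurable (fun y => F y + G y)%E.
Proof.
move=> mF mG d T phi mphi.
by apply: emeasurable_funD; [exact: mF|exact: mG].
Qed.

Lemma vec_measurableZl (c : \bar R) F :
  vec_measurable F -> vec_measurable (fun y => c * F y)%E.
Proof.
move=> mF d T phi mphi.
by apply: emeasurable_funM; [exact: measurable_cst|exact: mF].
Qed.

Lemma le_intRN_nng F G : (forall y, 0 <= F y)%E -> (forall y, F y <= G y)%E ->
  (intRN_nng F <= intRN_nng G)%E.
Proof. by move=> F0 FG; exact: le_iint. Qed.

Lemma intRN_nng_ge0 F : (forall y, 0 <= F y)%E -> (0 <= intRN_nng F)%E.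
Proof. by move=> F0; exact: iint_ge0. Qed.

Lemma intRN_nngD F G : vec_measurable F -> vec_measurable G ->
  (forall y, 0 <= F y)%E -> (forall y, 0 <= G y)%E ->
  (intRN_nng (fun y => F y + G y) = intRN_nng F + intRN_nng G)%E.
Proof. by move=> *; exact: iintD. Qed.

Lemma intRN_nngZl (c : \bar R) F : vec_measurable F -> (forall y, 0 <= F y)%E ->
  (0 <= c)%E -> (intRN_nng (fun y => c * F y) = c * intRN_nng F)%E.
Proof.
move=> mF F0 c0; rewrite muleC -iintZr//.
by congr iint; apply/funext => x; rewrite muleC.
Qed.

(** The signs 1 and -1 serve the two terms [u (x + y)] and [u (x - y)] of the second difference. *)
Lemma intRN_nng_affine F (a : 'rV[R]_N) (s : R) : s = 1 \/ s = -1 ->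
  vec_measurable F -> (forall y, 0 <= F y)%E ->
  intRN_nng (fun y => F (a + s *: y)) = intRN_nng F.
Proof.
move=> hs mF F0.
rewrite /intRN_nng -(@iint_affine N (coef a) s (fun x => F (vec_of N x)) hs mF)//.
by congr iint; apply/funext => x; rewrite -vec_of_affine.
Qed.

Lemma intRN_nng_prod (h : 'I_N -> R -> \bar R) :
  (forall i, measurable_fun setT (h i)) -> (forall i t, 0 <= h i t)%E ->
  vec_measurable (fun y => \prod_(i < N) h i (y ord0 i))%E /\
  intRN_nng (fun y => \prod_(i < N) h i (y ord0 i))%E =
    (\prod_(i < N) \int[mu]_t h i t)%E.
Proof.
move=> mh h0.
pose g (k : nat) : R -> \bar R := if insub k is Some i then h i else cst 0%E.
have mg k : measurable_fun setT (g k).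
  by rewrite /g; case: insubP => [i _ _|_]; [exact: mh|exact: measurable_cst].
have g0 k t : (0 <= g k t)%E by rewrite /g; case: insubP.
have E x : (\prod_(i < N) h i (vec_of N x ord0 i) = \prod_(i < N) g i (x i))%E.
  by apply: eq_bigr => i _; rewrite mxE /g valK.
split.
  by move=> d T phi mphi; under eq_fun do rewrite E; exact: coord_measurable_prod.
rewrite /intRN_nng (_ : (fun x => _) = (fun x => \prod_(i < N) g i (x i))%E).
  by rewrite iint_prod//; apply: eq_bigr => i _; rewrite /g valK.
by apply/funext => x; exact: E.
Qed.

End iterated_integral.

(** * An integrable product weight dominating the truncated kernel *)

Lemma ler_powRl (R : realType) (c x y : R) :
  0 <= c -> 0 <= x -> x <= y -> x `^ c <= y `^ c.
Proof.
by move=> c0 x0 xy; apply: ge0_ler_powR => //; rewrite nnegrE// (le_trans x0).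
Qed.

Section one_dimensional_weight.
Variable R : realType.
Local Notation mu := (@lebesgue_measure R).
Variable a : R.
Hypothesis a0 : 0 < a.

(** This is the derivative of [prim] below, hence explicitly integrable on the half-line. It is
    comparable to [t^(a-1)] near 0 and to [t^(-1-a)] at infinity; the factor 4 makes it dominate
    these powers there. *)
Definition hdens (t : R) : R := 4 * t `^ (a - 1) * (1 + t `^ a) `^ (-2).

(* [+oo] at 0 so that the product weight dominates also on coordinate hyperplanes. *)
Definition weight (t : R) : \bar R := if t == 0 then +oo%E else (hdens `|t|)%:E.

Let prim (t : R) : R := - (4 / a) * (1 + t `^ a) `^ (-1).

Lemma hdens_ge0 t : 0 <= hdens t.
Proof. by rewrite !mulr_ge0 ?powR_ge0. Qed.

Lemma weight_ge0 t : (0 <= weight t)%E.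
Proof. by rewrite /weight; case: ifP => // _; rewrite lee_fin hdens_ge0. Qed.

Lemma weight_pos (t : R) : 0 < t -> weight t = (hdens t)%:E.
Proof. by move=> t0; rewrite /weight (gt_eqF t0) (gtr0_norm t0). Qed.

Lemma weight_opp (t : R) : weight (- t) = weight t.
Proof. by rewrite /weight oppr_eq0 normrN. Qed.

Lemma measurable_weight : measurable_fun setT weight.
Proof.
have mp : measurable_fun setT (fun t : R => `|t| `^ a).
  apply: (measurableT_comp (f := fun s => s `^ a)); first exact: measurable_powR.
  exact: normr_measurable.
apply: measurable_fun_ifT; first exact: measurable_fun_eqr.
  exact: measurable_cst.
apply/measurable_EFinP; apply: measurable_funM.
  apply: measurable_funM => //.
  apply: (measurableT_comp (f := fun s => s `^ (a - 1))); first exact: measurable_powR.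
  exact: normr_measurable.
apply: (measurableT_comp (f := fun s => s `^ (-2))); first exact: measurable_powR.
exact: measurable_funD.
Qed.

Let is_derive_prim (x : R) : 0 < x -> is_derive x (1:R) prim (hdens x).
Proof.
move=> x0.
have d1 : is_derive x (1:R) (fun t : R => 1 + t `^ a) (a * x `^ (a - 1)).
  have -> : a * x `^ (a - 1) = 0 + a * x `^ (a - 1) by rewrite add0r.
  apply: is_deriveD; exact: is_derive1_powR.
have p1 : 0 < 1 + x `^ a by rewrite ltr_pwDl ?powR_ge0.
have d2 := is_derive1_powR (-1) p1.
have d3 : is_derive x (1:R) (fun t : R => (1 + t `^ a) `^ (-1))
   (-1 * (1 + x `^ a) `^ (-1 - 1) * (a * x `^ (a - 1))).
  exact: (is_derive1_comp (f := fun s => s `^ (-1)) (g := fun t : R => 1 + t `^ a)).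
have := is_deriveZ (- (4 / a)) d3.
rewrite (_ : -1 - 1 = -2); last by ring.
rewrite /hdens -[_ *: _]/(_ * _).
rewrite (_ : - (4 / a) * _ = 4 * x `^ (a - 1) * (1 + x `^ a) `^ (-2))//.
by field; rewrite gt_eqF.
Qed.

Let continuous_hdens (x : R) : 0 < x -> {for x, continuous hdens}.
Proof.
have cpow (c y : R) : 0 < y -> {for y, continuous (fun s : R => s `^ c)}.
  move=> y0; apply/differentiable_continuous/derivable1_diffP.
  by case: (is_derive1_powR c y0).
move=> x0; rewrite /hdens; apply: cvgM.
  by apply: cvgM; [exact: cvg_cst|exact: cpow].
apply: (@continuous_comp _ _ _ (fun t : R => 1 + t `^ a) (fun s => s `^ (-2))).
  by apply: cvgD; [exact: cvg_cst|exact: cpow].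
by apply: cpow; rewrite ltr_pwDl ?powR_ge0.
Qed.

(** The primitive takes values between [- (4 / a)] and 0, so its increments are bounded
    independently of the segment. *)
Let integral_hdens_segment (c d : R) : 0 < c -> c < d ->
  (\int[mu]_(x in `[c, d]) (hdens x)%:E <= (4 / a)%:E)%E.
Proof.
move=> c0 cd.
have cprim (x : R) : 0 < x -> {for x, continuous prim}.
  move=> x0; apply/differentiable_continuous/derivable1_diffP.
  by case: (is_derive_prim x0).
rewrite (@continuous_FTC2 _ _ prim) //.
- rewrite -EFinB lee_fin /prim -[leRHS]mulr1.
  have [p1 p2] : 0 < 1 + d `^ a /\ 1 <= 1 + c `^ a.
    by rewrite ltr_pwDl ?powR_ge0// lerDl powR_ge0.
  have pa : 0 < 4 / a by rewrite divr_gt0.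
  have : (1 + c `^ a) `^ (-1) <= 1.
    have p3 : 0 < 1 + c `^ a by exact: lt_le_trans p2.
    by rewrite powR_inv1 ?invf_le1// ltW.
  have : 0 <= (1 + d `^ a) `^ (-1) by rewrite powR_ge0.
  move: ((1 + d `^ a) `^ (-1)) ((1 + c `^ a) `^ (-1)) pa => X Y.
  by move: (4 / a) => K; nra.
- apply: continuous_in_subspaceT => x; rewrite inE /= in_itv /= => /andP[cx _].
  by apply: continuous_hdens; exact: lt_le_trans cx.
- split.
  + move=> x; rewrite in_itv /= => /andP[cx _].
    by case: (is_derive_prim (lt_trans c0 cx)).
  + by apply: cvg_within_filter; exact: cprim.
  + by apply: cvg_within_filter; apply: cprim; exact: lt_trans cd.
- move=> x; rewrite in_itv /= => /andP[cx _]; rewrite derive1E.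
  by case: (is_derive_prim (lt_trans c0 cx)).
Qed.

Let integral_weight_pos : (\int[mu]_(x in `]0%R, +oo[) weight x <= (4 / a)%:E)%E.
Proof.
(* Monotone convergence along an exhaustion by compact segments; starting from 2 keeps every segment
   nondegenerate. *)
pose A (n : nat) := `[n.+2%:R^-1, n.+2%:R]%classic : set R.
have AU : `]0%R, +oo[%classic = \bigcup_n A n.
  apply/seteqP; split=> x /=; rewrite in_itv /= andbT.
    move=> x0; exists (Num.bound (x + x^-1)) => //; rewrite /A /= in_itv /=.
    have xV : 0 < x^-1 by rewrite invr_gt0.
    have b : x + x^-1 < (Num.bound (x + x^-1)).+2%:R.
      apply: (lt_trans (archi_boundP _)); first by rewrite ltW // addr_gt0.
      by rewrite ltr_nat.
    apply/andP; split; last by apply: ltW; apply: lt_trans b; rewrite ltrDl.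
    rewrite invf_ple ?posrE//; apply: ltW; apply: lt_trans b; rewrite ltrDr.
    exact: x0.
  by case=> n _; rewrite /A /= in_itv /= => /andP[+ _]; apply: lt_le_trans; rewrite invr_gt0.
have nA : nondecreasing_seq A.
  move=> m n mn; apply/subsetPset => x; rewrite /A /= !in_itv /= => /andP[h1 h2].
  apply/andP; split.
    by apply: le_trans h1; rewrite lef_pV2 ?posrE// ler_nat !ltnS.
  by apply: le_trans h2 _; rewrite ler_nat !ltnS.
have cv : (\int[mu]_(x in A n) weight x)%E @[n --> \oo] -->
    (\int[mu]_(x in \bigcup_n A n) weight x)%E.
  apply: ge0_nondecreasing_set_cvg_integral => //.
  - by move=> n; exact: measurable_itv.
  - by move=> n; apply: measurable_funTS; exact: measurable_weight.
  - by move=> n x _; exact: weight_ge0.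
rewrite AU -(cvg_lim _ cv)//; apply: lime_le; first by apply: cvgP; exact: cv.
near=> n.
have c0 : (0 : R) < n.+2%:R^-1 by rewrite invr_gt0.
have cd : (n.+2%:R^-1 : R) < n.+2%:R.
  by rewrite (@lt_trans _ _ 1)// ?invf_lt1// ltr1n.
apply: le_trans (integral_hdens_segment c0 cd).
rewrite le_eqVlt; apply/orP; left; apply/eqP; apply: eq_integral => x.
rewrite inE /A /= in_itv /= => /andP[cx _].
have x0 : 0 < x by exact: lt_le_trans cx.
by rewrite (weight_pos x0).
Unshelve. all: by end_near. Qed.

Lemma integral_weight_lty : (\int[mu]_t weight t < +oo)%E.
Proof.
pose f := (weight \_ `]0%R, +oo[)%E.
have mf : measurable_fun setT f.
  apply/(measurable_restrictT weight (measurable_itv _)).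
  by apply: measurable_funTS; exact: measurable_weight.
have f0 t : (0 <= f t)%E by apply: erestrict_ge0 => ? _; exact: weight_ge0.
have If : (\int[mu]_t f t <= (4 / a)%:E)%E by rewrite -integral_mkcond.
have mfN : measurable_fun setT (fun t : R => f (0 + -1 * t)).
  by apply: (measurableT_comp mf); apply: measurable_funD => //; exact: measurable_funM.
(* The point 0, where the weight is infinite, has measure zero. The rest is covered by the positive
   half-line and its reflection. *)
rewrite -(@integral_setD1 _ _ 0); last 2 first.
- exact: measurableD.
- by apply: measurable_funTS; exact: measurable_weight.
rewrite integral_mkcond.
apply: (@le_lt_trans _ _ (\int[mu]_t (f t + f (0 + -1 * t)%R))%E).
  apply: ge0_le_integral_nomeas => t.
    by apply: erestrict_ge0 => ? _; exact: weight_ge0.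
  rewrite {1}/patch; case: ifPn => [|_]; last by rewrite adde_ge0.
  rewrite inE /= => -[_ /eqP t0]; case: (ltrP 0 t) => ht.
    rewrite [f t]/f /patch mem_set ?leeDl//=; last by rewrite in_itv /= ht.
  have ht' : 0 < - t by rewrite oppr_gt0 lt_neqAle t0 ht.
  rewrite [f (_ + _)]/f /patch mem_set; last by rewrite /= in_itv /= add0r mulN1r ht'.
  by rewrite add0r mulN1r weight_opp leeDr.
have E := @ge0_integral_affine R 0 (-1) (or_intror erefl) f mf f0.
rewrite ge0_integralD; [|exact: measurableT|by move=> t _; exact: f0|exact: mf
  |by move=> t _; exact: f0|exact: mfN].
have If' := eq_ind_r (fun z => (z <= (4 / a)%:E)%E) If E.
by apply: (le_lt_trans (leeD If If')); rewrite ltry.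
Qed.

(* [min (r^(a-1)) (r^(-1-a))] is nonincreasing, hence evaluating it at a smaller
   argument [|t| <= r] only increases it. *)
Lemma le_weight (t r : R) : a <= 1 -> `|t| <= r ->
  ((if r <= 1 then r `^ (a - 1) else r `^ (- 1 - a))%:E <= weight t)%E.
Proof.
move=> a1 tr; rewrite /weight; case: eqP => [_|/eqP t0]; first by rewrite leey.
have {}t0 : 0 < `|t| by rewrite normr_gt0.
have [s Es] : exists s : R, s = `|t| by exists `|t|.
rewrite -Es in t0 tr *; move: t0 tr => s0 sr; rewrite lee_fin /hdens.
have r0 : 0 < r by exact: lt_le_trans sr.
have one : (1 : R) `^ a = 1 by rewrite powR1.
have anti (x y c : R) : 0 < x -> x <= y -> c <= 0 -> y `^ c <= x `^ c.
  move=> x0 xy c0; have y0 := lt_le_trans x0 xy.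
  rewrite -[c]opprK !(powRN _ (- c)) lef_pV2 ?posrE ?powR_gt0//.
  by apply: ler_powRl; rewrite ?oppr_ge0//; apply: ltW.
have a1' : a - 1 <= 0 by rewrite subr_le0.
have a1'' : -1 - a <= 0 by rewrite -opprD oppr_le0 addr_ge0// ltW.
have p0 : 0 < s `^ a by rewrite powR_gt0.
have [s1|s1] := lerP s 1.
  have h1 : r `^ (a - 1) <= s `^ (a - 1) by exact: anti.
  (* For [s <= 1] one has [(1 + s^a)^2 <= 4]. *)
  have h2 : s `^ (a - 1) <= 4 * s `^ (a - 1) * (1 + s `^ a) `^ (-2).
    have sa1 : s `^ a <= 1.
      by rewrite -[leRHS]one; apply: ler_powRl => //; exact: ltW.
    rewrite mulrAC ler_peMl ?powR_ge0// powRN powR_mulrn; last lra.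
    by rewrite ler_pdivlMr; [rewrite mul1r; nra|rewrite exprn_gt0//; lra].
  case: ifPn => r1; first exact: le_trans h2.
  rewrite -ltNge in r1; apply: le_trans h2; apply: (@le_trans _ _ 1).
    apply: (@le_trans _ _ (r `^ 0)); last by rewrite powRr0.
    by apply: ler_powR; [exact: ltW|exact: a1''].
  apply: (@le_trans _ _ (s `^ 0)); first by rewrite powRr0.
  by apply: ger_powR => //; rewrite s0.
have r1 : 1 < r by exact: lt_le_trans sr.
rewrite (lt_geF r1); apply: (@le_trans _ _ (s `^ (-1 - a))).
  exact: anti.
have sa1 : 1 <= s `^ a.
  by rewrite -[leLHS]one; apply: ler_powRl => //; exact: ltW.
(* For [s > 1] the inequality reduces to [(1 + s^a)^2 <= 4 s^(2a)]. *)
have -> : s `^ (-1 - a) = s `^ (a - 1) / (s `^ a) ^+ 2.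
  rewrite -powR_mulrn ?powR_ge0// -powRrM -powRB; last by rewrite (gt_eqF s0) implybT.
  by congr powR; ring.
rewrite [4 * _]mulrC -mulrA ler_pM2l ?powR_gt0// powRN powR_mulrn; last lra.
have p1 : 0 < (1 + s `^ a) ^+ 2 by rewrite exprn_gt0//; lra.
rewrite ler_pdivlMr// mulrC ler_pdivrMr ?exprn_gt0//.
by move: (s `^ a) sa1 {p0 p1} => z; nra.
Qed.

End one_dimensional_weight.

Section kernel.
Variables (R : realType) (N : nat) (alpha : R).
Local Notation mu := (@lebesgue_measure R).
Hypotheses (N2 : (2 <= N)%N) (al0 : 0 < alpha) (al1 : alpha < 1).
Implicit Types y z : 'rV[R]_N.

(** Reference majorant for second differences: quadratic at the origin, and of order
    [alpha < 2 alpha] at infinity, so its quotient by the kernel power is integrable. Growth at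
    infinity, instead of a constant, leaves room for the scaling in [quad_growth_scaled_le]. *)
Definition quad_growth y : R :=
  if enorm y <= 1 then enorm y ^+ 2 else enorm y `^ alpha.

(** The first bound on [N * wexp] serves the decay at infinity, the second the singularity at the
    origin. *)
Definition wexp : R := Num.min (alpha / N%:R) ((2 - 2 * alpha) / N%:R).

Definition weightN y : \bar R := (\prod_(i < N) weight wexp (y ord0 i))%E.

Let N0 : 0 < N%:R :> R. Proof. by rewrite ltr0n (leq_trans _ N2). Qed.

Lemma wexp_gt0 : 0 < wexp.
Proof. by rewrite lt_min !divr_gt0//; move: al1; lra. Qed.

Let wexpN1 : wexp * N%:R <= alpha.
Proof. by rewrite -ler_pdivlMr// ge_min lexx. Qed.

Let wexpN2 : wexp * N%:R <= 2 - 2 * alpha.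
Proof. by rewrite -ler_pdivlMr// ge_min lexx orbT. Qed.

Lemma enorm_ge0 y : 0 <= enorm y.
Proof. exact: sqrtr_ge0. Qed.

Lemma sqr_enorm y : enorm y ^+ 2 = \sum_(i < N) y ord0 i ^+ 2.
Proof. by rewrite sqr_sqrtr// sumr_ge0// => i _; exact: sqr_ge0. Qed.

Lemma coord_le_enorm y i : `|y ord0 i| <= enorm y.
Proof.
rewrite -ler_sqr ?nnegrE ?enorm_ge0// sqr_enorm real_normK ?num_real//.
by rewrite (bigD1 i)//= lerDl sumr_ge0// => j _; exact: sqr_ge0.
Qed.

Lemma quad_growth_ge0 y : 0 <= quad_growth y.
Proof. by rewrite /quad_growth; case: ifP; rewrite ?sqr_ge0 ?powR_ge0. Qed.

Lemma weightN_ge0 y : (0 <= weightN y)%E.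
Proof. by apply: prode_ge0 => i _; exact: weight_ge0. Qed.

(** Every coordinate is at most [r = |y|] in absolute value, so each factor of the weight is at
    least the same radial quantity [kap], and [kap^N] dominates the kernel by the choice of
    [wexp]. *)
Lemma kernel_le_weightN y :
  ((quad_growth y / enorm y `^ (N%:R + 2 * alpha))%:E <= weightN y)%E.
Proof.
have := enorm_ge0 y; rewrite le_eqVlt => /predU1P[e0|e0].
  (* At the origin the kernel takes the default value 0, the inverse of 0 being 0. *)
  rewrite -e0 powR0 ?invr0 ?mulr0 ?weightN_ge0//.
  by rewrite gt_eqF// addr_gt0// mulr_gt0.
have eN0 : enorm y != 0 by rewrite gt_eqF.
set r := enorm y in e0 eN0 *.
pose kap : R := if r <= 1 then r `^ (wexp - 1) else r `^ (- 1 - wexp).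
have kap0 : 0 <= kap by rewrite /kap; case: ifP => _; exact: powR_ge0.
have a1 : wexp <= 1.
  have : wexp * 1 <= wexp * N%:R.
    by rewrite ler_pM2l ?wexp_gt0// ler1n (leq_trans _ N2).
  by move: wexpN1 al0 al1; lra.
apply: (@le_trans _ _ (kap ^+ N)%:E).
  rewrite lee_fin /quad_growth -/r /kap; case: ifPn => r1.
    rewrite -(@powR_mulrn _ r 2) ?(ltW e0)// -[in leRHS]powR_mulrn ?powR_ge0//.
    rewrite -powRrM -powRB ?eN0 ?implybT//.
    apply: ger_powR; first by rewrite e0.
    by move: wexpN2; lra.
  rewrite -ltNge in r1.
  rewrite -powR_mulrn ?powR_ge0// -powRrM -powRB ?eN0 ?implybT//.
  apply: ler_powR; first exact: ltW.
  by move: wexpN1 al0 al1; lra.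
have kw i : (kap%:E <= weight wexp (y ord0 i))%E.
  by apply: le_weight => //; [exact: wexp_gt0|exact: coord_le_enorm].
have H n (f : 'I_n -> \bar R) : (forall i, kap%:E <= f i)%E ->
    ((kap ^+ n)%:E <= \prod_(i < n) f i)%E.
  elim: n f => [|n IH] f kf; first by rewrite big_ord0 expr0.
  rewrite big_ord_recl exprS EFinM; apply: lee_pmul => //.
    by rewrite lee_fin exprn_ge0.
  exact: IH.
exact: H.
Qed.

Lemma vec_measurable_weightN : vec_measurable weightN.
Proof.
have [] // := @intRN_nng_prod _ N (fun=> weight wexp).
  by move=> _; exact: measurable_weight.
by move=> _ t; exact: weight_ge0.
Qed.

Definition weight_mass : R := fine (intRN_nng weightN).

Lemma intRN_nng_weightN : intRN_nng weightN = weight_mass%:E.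
Proof.
rewrite fineK// ge0_fin_numE; last by apply: intRN_nng_ge0; exact: weightN_ge0.
have [|_ t|_ ->] := @intRN_nng_prod _ N (fun=> weight wexp).
- by move=> _; exact: measurable_weight.
- exact: weight_ge0.
(* Nonnegativity is carried along because finiteness of a product of extended reals requires it. *)
have [] : (0 <= \prod_(i < N) \int[mu]_t weight wexp t)%E /\
    (\prod_(i < N) \int[mu]_t weight wexp t < +oo)%E.
  apply: (big_ind (fun x : \bar R => 0 <= x /\ x < +oo)%E).
  - by rewrite ltry.
  - move=> x y [x0 xy] [y0 yy]; split; first exact: mule_ge0.
    by apply: lte_mul_pinfty => //; rewrite ge0_fin_numE.
  - move=> i _; split; first by apply: integral_ge0 => t _; exact: weight_ge0.
    exact: integral_weight_lty wexp_gt0.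
by [].
Qed.

Lemma weight_mass_ge0 : 0 <= weight_mass.
Proof. by rewrite fine_ge0// intRN_nng_ge0//; exact: weightN_ge0. Qed.

End kernel.

(** * Parabolic caps *)

Lemma bernoulli_le (R : realType) (w : R) n : 0 <= w -> 1 + n%:R * (w - 1) <= w ^+ n.
Proof.
move=> w0; elim: n => [|n IH]; first by rewrite mul0r addr0 expr0.
have n0 : 0 <= n%:R :> R by rewrite ler0n.
apply: le_trans (_ : w * (1 + n%:R * (w - 1)) <= _); last first.
  by rewrite exprS ler_wpM2l.
rewrite -natr1; have : 0 <= n%:R * (w - 1) ^+ 2 by rewrite mulr_ge0// sqr_ge0.
by nra.
Qed.

Section euclidean.
Variables (R : realType) (N : nat).
Implicit Types x y z : 'rV[R]_N.

Definition dot x y : R := \sum_(i < N) x ord0 i * y ord0 i.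

Lemma sqr_enormD x y :
  enorm (x + y) ^+ 2 = enorm x ^+ 2 + 2 * dot x y + enorm y ^+ 2.
Proof.
rewrite !sqr_enorm mulr_sumr -!big_split /=; apply: eq_bigr => i _.
by rewrite mxE; ring.
Qed.

Lemma enormN x : enorm (- x) = enorm x.
Proof. by congr Num.sqrt; apply: eq_bigr => i _; rewrite mxE sqrrN. Qed.

Lemma dotNr x y : dot x (- y) = - dot x y.
Proof. by rewrite -sumrN; apply: eq_bigr => i _; rewrite mxE mulrN. Qed.

Lemma enorm0 : enorm (0 : 'rV[R]_N) = 0.
Proof. by rewrite /enorm big1 ?sqrtr0// => i _; rewrite mxE expr0n. Qed.

Lemma enorm_eq0 x : enorm x = 0 -> x = 0.
Proof.
move=> x0; apply/rowP => i; rewrite mxE; apply/eqP.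
by rewrite -normr_le0 -x0 coord_le_enorm.
Qed.

Lemma norm_dot_le x y : `|dot x y| <= enorm x * enorm y.
Proof.
have [y0|y0] := eqVneq (enorm y) 0.
  rewrite y0 mulr0 (enorm_eq0 y0) /dot big1 ?normr0// => i _.
  by rewrite mxE mulr0.
have {}y0 : 0 < enorm y ^+ 2 by rewrite exprn_gt0// lt_neqAle eq_sym y0 enorm_ge0.
rewrite -ler_sqr ?nnegrE ?mulr_ge0 ?enorm_ge0// real_normK ?num_real// exprMn.
rewrite -subr_ge0 -(pmulr_rge0 _ y0).
set A := enorm x ^+ 2; set B := enorm y ^+ 2; set C := dot x y.
(* Cauchy-Schwarz from the squared norm of [|y|^2 x - (x.y) y]. *)
have -> : B * (A * B - C ^+ 2) = \sum_(i < N) (B * x ord0 i - C * y ord0 i) ^+ 2.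
  transitivity (\sum_(i < N) (B ^+ 2 * x ord0 i ^+ 2 +
      (- (2 * B * C) * (x ord0 i * y ord0 i) + C ^+ 2 * y ord0 i ^+ 2))).
    rewrite !big_split /= -!mulr_sumr -!sqr_enorm -/A -/B -/(dot x y) -/C.
    by ring.
  by apply: eq_bigr => i _; ring.
by apply: sumr_ge0 => i _; exact: sqr_ge0.
Qed.

Lemma enormD_le x y : enorm (x + y) <= enorm x + enorm y.
Proof.
rewrite -ler_sqr ?nnegrE ?addr_ge0 ?enorm_ge0// sqr_enormD sqrrD.
have := norm_dot_le x y; rewrite ler_norml => /andP[_ h].
by rewrite lerD2r lerD2l -[leRHS]mulr_natl ler_wpM2l.
Qed.

Lemma continuous_sqr_enorm x0 : continuous (fun x => enorm (x - x0) ^+ 2).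
Proof.
have -> : (fun x => enorm (x - x0) ^+ 2) =
    (fun x => \sum_(i < N) (x ord0 i - x0 ord0 i) ^+ 2).
  by apply/funext => x; rewrite sqr_enorm; apply: eq_bigr => i _; rewrite !mxE.
apply: continuous_big => [|i _ x]; first exact: add_continuous.
have c : {for x, continuous (fun z : 'rV[R]_N => z ord0 i - x0 ord0 i)}.
  by apply: continuousB; [exact: coord_continuous|exact: cst_continuous].
exact: (continuousM c c).
Qed.

Definition cap x0 (r : R) x : R := Num.max 0 (r ^+ 2 - enorm (x - x0) ^+ 2).

Lemma cap_ge0 x0 r x : 0 <= cap x0 r x.
Proof. by rewrite le_max lexx. Qed.

Lemma continuous_cap x0 r : continuous (cap x0 r).
Proof.
move=> x.
have c : {for x, continuous (fun z : 'rV[R]_N => r ^+ 2 - enorm (z - x0) ^+ 2)}.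
  by apply: continuousB; [exact: cst_continuous|exact: continuous_sqr_enorm].
apply: (@continuous_max R 'rV[R]_N (fun=> 0) _ x _ c).
exact: cst_continuous.
Qed.

Lemma cap_center x0 r : cap x0 r x0 = r ^+ 2.
Proof. by rewrite /cap subrr enorm0 expr0n subr0; apply/max_idPr; rewrite sqr_ge0. Qed.

Lemma cap_le x0 r x : cap x0 r x <= r ^+ 2.
Proof. by rewrite ge_max sqr_ge0 /= gerBl sqr_ge0. Qed.

Lemma cap_gt0E x0 r x : 0 < cap x0 r x ->
  cap x0 r x = r ^+ 2 - enorm (x - x0) ^+ 2.
Proof. by rewrite lt_max ltxx /= => h; apply/max_idPr; exact: ltW. Qed.

Lemma cap_gt0_enorm x0 r x : 0 <= r -> 0 < cap x0 r x -> enorm (x - x0) <= r.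
Proof.
move=> r0 /[dup] /cap_gt0E ->; rewrite subr_gt0 => /ltW.
by rewrite ler_sqr ?nnegrE ?enorm_ge0.
Qed.

Lemma cap_outside x0 r x : 0 <= r -> r <= enorm (x - x0) -> cap x0 r x = 0.
Proof.
move=> r0 rx; apply/max_idPl; rewrite subr_le0 ler_sqr ?nnegrE//.
exact: enorm_ge0.
Qed.

(** At [x] the truncation is inactive, and at [x + y] it can only raise the value. *)
Lemma cap_shift_ge x0 r x y : 0 < cap x0 r x ->
  cap x0 r x - enorm y ^+ 2 - 2 * dot (x - x0) y <= cap x0 r (x + y).
Proof.
move=> /cap_gt0E ->; rewrite le_max; apply/orP; right.
have -> : x + y - x0 = (x - x0) + y by rewrite addrAC.
by rewrite (sqr_enormD (x - x0) y); lra.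
Qed.

(** The linear terms in [y] and [- y] cancel. *)
Lemma cap_second_difference x0 r x y : 0 < cap x0 r x ->
  2 * cap x0 r x - 2 * enorm y ^+ 2 <= cap x0 r (x + y) + cap x0 r (x - y).
Proof.
move=> b0; have h1 := cap_shift_ge y b0; have h2 := cap_shift_ge (- y) b0.
by rewrite dotNr enormN in h2; lra.
Qed.

Lemma global_max (f : 'rV[R]_N -> R) x0 r : 0 < r -> continuous f ->
  (forall x, 0 <= f x) -> (forall x, r <= enorm (x - x0) -> f x = 0) ->
  exists x1, forall x, f x <= f x1.
Proof.
move=> r0 cf f0 fout.
(* A compact cube containing the ball; outside it the function is zero, hence below the maximum
   found on the cube. *)
pose A := [set v : 'rV[R]_N | forall i, `[x0 ord0 i - r, x0 ord0 i + r]%classic (v ord0 i)].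
have cA : compact A.
  by apply: (@rV_compact R N (fun i => `[x0 ord0 i - r, x0 ord0 i + r]%classic)) => i;
    exact: segment_compact.
have A0 : A !=set0 by exists x0 => i /=; rewrite in_itv /=; apply/andP; split; lra.
have [x1 _ x1max] := EVT_max_rV A0 cA (continuous_subspaceT cf).
exists x1 => x; have [xA|xA] := pselect (A x); first by apply: x1max; rewrite inE.
rewrite fout// leNgt; apply/negP => /ltW h; apply: xA => i /=.
have := le_trans (coord_le_enorm (x - x0) i) h.
by rewrite !mxE ler_distl in_itv /=.
Qed.

End euclidean.

(** * Comparison principles for the integral operator *)

Section signed_integral.
Variables (R : realType) (N : nat).
Implicit Types (c y : 'rV[R]_N) (f : 'rV[R]_N -> R) (P Q : 'rV[R]_N -> \bar R).

(** The positive part is bounded above by [P] and the negative part below by [Q]; monotonicity alone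
    suffices. *)
Lemma intRN_le f P Q :
  (forall y, (Num.max (f y) 0)%:E <= P y)%E ->
  (forall y, 0 <= Q y)%E -> (forall y, Q y <= (Num.max (- f y) 0)%:E)%E ->
  (intRN f <= intRN_nng P - intRN_nng Q)%E.
Proof.
move=> fP Q0 Qf; apply: leeB; last exact: le_intRN_nng.
by apply: le_intRN_nng => // y; rewrite lee_fin le_max lexx orbT.
Qed.

Lemma intRN_ge f P : (forall y, (Num.max (- f y) 0)%:E <= P y)%E ->
  (- intRN_nng P <= intRN f)%E.
Proof.
move=> fP; rewrite -[leLHS]add0e; apply: leeB.
  by apply: intRN_nng_ge0 => y; rewrite lee_fin le_max lexx orbT.
by apply: le_intRN_nng => // y; rewrite lee_fin le_max lexx orbT.
Qed.

(** Meant for splitting into near and far [y]: [P] controls the near part, and in the far part each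
    of [v (x + y)], [v (x - y)] has the same integral [l] as [v]. *)
Lemma intRN_ge_shift f P (v : 'rV[R]_N -> R) (x : 'rV[R]_N) (c p l : R) :
  vec_measurable P -> (forall y, 0 <= P y)%E -> intRN_nng P = p%:E ->
  vec_measurable (fun z => (v z)%:E) -> (forall z, 0 <= v z) ->
  intRN_nng (fun z => (v z)%:E) = l%:E -> 0 <= c ->
  (forall y, (Num.max (- f y) 0)%:E <= P y \/
    (Num.max (- f y) 0)%:E <= (c * (v (x + y) + v (x - y)))%:E)%E ->
  ((- (p + c * (l + l)))%:E <= intRN f)%E.
Proof.
move=> mP P0 IP mv v0 Iv c0 fP.
pose S (s : R) y := (c%:E * (v (x + s *: y))%:E)%E.
have S0 s y : (0 <= S s y)%E by rewrite mule_ge0 ?lee_fin.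
have mS s : vec_measurable (S s).
  by apply: vec_measurableZl; exact: (vec_measurable_affine x s mv).
have IS (s : R) : s = 1 \/ s = -1 -> intRN_nng (S s) = (c * l)%:E.
  move=> hs; rewrite (intRN_nngZl (vec_measurable_affine x s mv)).
  - by rewrite (intRN_nng_affine x hs mv) ?Iv.
  - by move=> y; rewrite lee_fin.
  - by rewrite lee_fin.
pose S2 y := (S 1%R y + S (-1)%R y)%E.
have S20 y : (0 <= S2 y)%E by rewrite adde_ge0.
have IS2 : intRN_nng S2 = (c * l + c * l)%:E.
  rewrite (intRN_nngD (mS 1) (mS (-1)) (S0 1) (S0 (-1))).
  by rewrite (IS 1 (or_introl erefl)) (IS (-1) (or_intror erefl)).
have IT : intRN_nng (fun y => P y + S2 y)%E = (p + c * (l + l))%:E.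
  rewrite (intRN_nngD mP (vec_measurableD (mS 1) (mS (-1))) P0 S20) IP IS2.
  by rewrite -EFinD mulrDr.
rewrite EFinN -IT; apply: intRN_ge => y.
have [h|h] := fP y; first by rewrite (le_trans h)// leeDl.
apply: (le_trans h); apply: le_trans (leeDr _ (P0 y)).
by rewrite /S2 /S scale1r scaleN1r -!EFinM -EFinD mulrDr.
Qed.

(** The indicator of a cube, in product form so that [intRN_nng_prod] computes its integral. *)
Definition box (c : 'rV[R]_N) (del : R) : 'rV[R]_N -> \bar R :=
  fun y => (\prod_(i < N) (\1_(`[c ord0 i - del, c ord0 i + del]%classic) (y ord0 i))%:E)%E.

Lemma box_ge0 c del y : (0 <= box c del y)%E.
Proof. by apply: prode_ge0 => i _; rewrite lee_fin. Qed.

Lemma box_in c del y : (forall i, `|y ord0 i - c ord0 i| <= del) -> box c del y = 1%E.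
Proof.
move=> yc; rewrite /box big1// => i _; rewrite indicE mem_set//=.
by rewrite in_itv /= -ler_distl.
Qed.

Lemma box_out c del y i : del < `|y ord0 i - c ord0 i| -> box c del y = 0%E.
Proof.
move=> yc; rewrite /box (bigD1 i)//= indicE memNset ?mul0e//=.
by rewrite in_itv /= -ler_distl leNgt yc.
Qed.

Lemma intRN_nng_box c (del k : R) : 0 < del -> 0 <= k ->
  intRN_nng (fun y => k%:E * box c del y)%E = (k * (2 * del) ^+ N)%:E.
Proof.
move=> del0 k0.
have [|i t|mb Ib] := @intRN_nng_prod _ N
  (fun i t => (\1_(`[c ord0 i - del, c ord0 i + del]%classic) t)%:E).
- by move=> i; apply/measurable_EFinP; exact: measurable_indic.
- by rewrite lee_fin.
rewrite intRN_nngZl//; last exact: box_ge0.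
rewrite EFinM; congr (_ * _)%E; rewrite /box Ib.
have E i : (\int[@lebesgue_measure R]_t
    (\1_(`[c ord0 i - del, c ord0 i + del]%classic) t)%:E = (2 * del)%:E)%E.
  rewrite integral_indic ?setIT//.
  rewrite [LHS]lebesgue_measure_itv /= lte_fin ifT; last by lra.
  by rewrite -EFinB; congr EFin; ring.
under eq_bigr do rewrite E.
elim: {c mb Ib E}N => [|n IH]; first by rewrite big_ord0.
by rewrite big_ord_recl IH exprS EFinM.
Qed.

End signed_integral.

Section comparison.
Variables (R : realType) (N : nat) (alpha : R) (u : 'rV[R]_N -> R).
Hypotheses (N2 : (2 <= N)%N) (al0 : 0 < alpha) (al1 : alpha < 1).
Implicit Types (x y : 'rV[R]_N).

Definition second_diff x y : R := 2 * u x - u (x + y) - u (x - y).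

Local Notation D := second_diff.
Local Notation g := (quad_growth alpha).
Local Notation J := (weight_mass N alpha).
Local Notation q := (N%:R + 2 * alpha).
Local Notation E := (fraclap_integrand alpha u).

Let W0 y : 0 <= enorm y `^ q. Proof. exact: powR_ge0. Qed.

Let max_le_weightN (c s : R) y : 0 <= c -> s <= c * g y ->
  ((Num.max (s / enorm y `^ q) 0)%:E <= c%:E * weightN alpha y)%E.
Proof.
move=> c0 sc; apply: (@le_trans _ _ (c%:E * (g y / enorm y `^ q)%:E)%E).
  rewrite -EFinM lee_fin ge_max mulr_ge0 ?divr_ge0 ?quad_growth_ge0// andbT.
  by rewrite mulrA ler_wpM2r// invr_ge0 powR_ge0.
by apply: lee_wpmul2l; rewrite ?lee_fin//; exact: kernel_le_weightN.
Qed.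

Let intRN_weightN (c : R) : 0 <= c ->
  intRN_nng (fun y => c%:E * weightN alpha y)%E = (c * J)%:E.
Proof.
move=> c0; rewrite intRN_nngZl//; last 2 first.
- exact: vec_measurable_weightN.
- exact: weightN_ge0.
by rewrite intRN_nng_weightN.
Qed.

(** The negative part of the integrand is at least [m / rho^q] on the cube of those [y] with [x + y]
    near [z0], a cube of volume [(2 del)^N]. This quantifies the nonlocal effect of mass near
    [z0]. *)
Lemma fraclap_le_mass x (c m del rho : R) (z0 : 'rV[R]_N) : 0 <= c -> 0 < m ->
  0 < del -> 0 < rho -> (forall y, D x y <= c * g y) ->
  (forall y, (forall i, `|y ord0 i - (z0 - x) ord0 i| <= del) ->
    D x y <= - m /\ enorm y <= rho) ->
  (intRN (E x) <= (c * J - m / rho `^ q * (2 * del) ^+ N)%:E)%E.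
Proof.
move=> c0 m0 del0 rho0 Dc Dm.
have k0 : 0 <= m / rho `^ q by rewrite divr_ge0 ?powR_ge0 ?ltW.
rewrite EFinB -intRN_weightN// -(intRN_nng_box (z0 - x))//.
apply: intRN_le => y.
- exact: (max_le_weightN c0 (Dc y)).
- by rewrite mule_ge0 ?lee_fin ?box_ge0.
have [yc|] := pselect (forall i, `|y ord0 i - (z0 - x) ord0 i| <= del); last first.
  move=> /existsNP[i /negP]; rewrite -ltNge => /box_out ->.
  by rewrite mule0 lee_fin le_max lexx orbT.
have [Dym yr] := Dm _ yc.
rewrite box_in// mule1 lee_fin le_max; apply/orP; left.
(* The second difference vanishes at [y = 0], which is incompatible with being at most [- m]. *)
have y0 : 0 < enorm y.
  rewrite lt_neqAle enorm_ge0 andbT eq_sym; apply/eqP => /enorm_eq0 y0.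
  by move: Dym; rewrite /D y0 addr0 subr0; lra.
rewrite /fraclap_integrand -mulNr.
apply: (@le_trans _ _ (m / enorm y `^ q)).
  rewrite ler_pM2l// lef_pV2 ?posrE ?powR_gt0//.
  apply: ler_powRl => //; first by rewrite addr_ge0// mulr_ge0// ltW.
  exact: ltW.
by rewrite ler_wpM2r ?invr_ge0 ?powR_ge0//; move: Dym; rewrite /D; lra.
Qed.

Lemma fraclap_le x (c : R) : 0 <= c -> (forall y, D x y <= c * g y) ->
  (intRN (E x) <= (c * J)%:E)%E.
Proof.
move=> c0 Dc.
(* The trivial lower bound 0 for the negative part is written as an integral to fit [intRN_le]. *)
have -> : ((c * J)%:E = (c * J)%:E - intRN_nng (fun y : 'rV[R]_N => 0%:E * box 0 1 y))%E.
  by rewrite intRN_nng_box// mul0r sube0.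
rewrite -intRN_weightN//; apply: intRN_le => y.
- exact: (max_le_weightN c0 (Dc y)).
- by rewrite mul0e.
- by rewrite mul0e lee_fin le_max lexx orbT.
Qed.

Lemma fraclap_ge x (c : R) : 0 <= c -> (forall y, - D x y <= c * g y) ->
  ((- (c * J))%:E <= intRN (E x))%E.
Proof.
move=> c0 Dc; rewrite EFinN -intRN_weightN//; apply: intRN_ge => y.
by rewrite /fraclap_integrand -mulNr; exact: (max_le_weightN c0 (Dc y)).
Qed.

Let v (z : 'rV[R]_N) : R := `|u z| * omega alpha z.

Definition L1_norm : R := fine (intRN_nng (fun z => (`| v z |)%:E)).

(** For each [y] either the near bound or the far bound may be used. Multiplying by [|y|^q] in the
    far bound anticipates the division by the kernel power. *)
Lemma fraclap_ge_L1 x (c c2 : R) : L1_omega alpha u -> 0 <= c -> 0 <= c2 ->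
  (forall y, - D x y <= c * g y \/
     (0 < enorm y /\ - D x y <= c2 * enorm y `^ q * (v (x + y) + v (x - y)))) ->
  ((- (c * J + c2 * (L1_norm + L1_norm)))%:E <= intRN (E x))%E.
Proof.
move=> [mv v1] c0 c20 Dc.
have v0 z : 0 <= v z.
  by rewrite mulr_ge0 ?normr_ge0// /omega divr_ge0// addr_ge0// powR_ge0.
apply: (@intRN_ge_shift R N _ (fun y => c%:E * weightN alpha y)%E (fun z => `| v z |) x).
- by apply: vec_measurableZl; exact: vec_measurable_weightN.
- by move=> y; rewrite mule_ge0 ?lee_fin ?weightN_ge0.
- exact: intRN_weightN.
- apply: vec_measurable_tuple; apply/measurable_EFinP.
  exact: measurableT_comp mv.
- by move=> z; exact: normr_ge0.
- rewrite fineK// ge0_fin_numE//; apply: intRN_nng_ge0 => z.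
  by rewrite lee_fin normr_ge0.
- exact: c20.
move=> y; rewrite /fraclap_integrand -mulNr.
have [h|[y0 h]] := Dc y; [left; exact: (max_le_weightN c0 h)|right].
rewrite (ger0_norm (v0 (x + y))) (ger0_norm (v0 (x - y))).
move: (v (x + y)) (v (x - y)) (v0 (x + y)) (v0 (x - y)) h => a b a0 b0 h.
rewrite lee_fin ge_max; apply/andP; split; last by rewrite mulr_ge0 ?addr_ge0.
by rewrite ler_pdivrMr ?powR_gt0// mulrAC.
Qed.

End comparison.

(** * Solutions *)

Section solutions.
Variables (R : realType) (N : nat) (alpha lambda p : R) (u : 'rV[R]_N -> R).
Hypotheses (N2 : (2 <= N)%N) (al0 : 0 < alpha) (al1 : alpha < 1).
Hypotheses (la0 : 0 < lambda) (p1 : 1 < p).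
Hypotheses (cu : continuous u) (u0 : forall x, 0 <= u x).
Hypothesis solu : forall x,
  intRN (fraclap_integrand alpha u x) = (lambda * u x - u x `^ p)%:E.
Implicit Types (x y z : 'rV[R]_N).

Local Notation D := (second_diff u).
Local Notation g := (quad_growth alpha).
Local Notation J := (weight_mass N alpha).
Local Notation q := (N%:R + 2 * alpha).

Let J0 : 0 <= J. Proof. exact: weight_mass_ge0. Qed.

(** The two bounds give [X <= M min(1, B|y|^2)], and [min(1, s) <= s^(alpha/2)]. The resulting
    coefficient tends to 0 with [B], which is the smallness needed when the cap is large at the
    touching point. *)
Lemma quad_growth_scaled_le (X M B : R) y : 0 <= M -> 0 < B <= 1 ->
  X <= M -> X <= M * B * enorm y ^+ 2 -> X <= M * B `^ (alpha / 2) * g y.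
Proof.
move=> M0 /andP[B0 B1] X1 X2; have ag : 0 <= alpha / 2 by rewrite divr_ge0 ?ltW.
have e0 := enorm_ge0 y.
have h : M * Num.min 1 (B * enorm y ^+ 2) <= M * (B `^ (alpha / 2) * g y).
  apply: ler_wpM2l => //; rewrite /quad_growth; case: ifPn => y1.
    rewrite ge_min; apply/orP; right; rewrite ler_wpM2r ?sqr_ge0//.
    apply: ger1_powR; first by rewrite B0.
    by move: al1; lra.
  have -> : enorm y `^ alpha = (enorm y ^+ 2) `^ (alpha / 2).
    by rewrite -powR_mulrn// -powRrM; congr powR; field.
  rewrite -powRM ?(ltW B0) ?sqr_ge0//.
  have [c1|c1] := lerP 1 (B * enorm y ^+ 2).
    apply: (@le_trans _ _ (1 `^ (alpha / 2))); first by rewrite powR1.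
    exact: ler_powRl.
  rewrite -ltNge in y1; apply: ger1_powR; last by move: al1; lra.
  by rewrite ltW// mulr_gt0// exprn_gt0// (lt_trans _ y1)// andbT.
apply: le_trans (_ : M * Num.min 1 (B * enorm y ^+ 2) <= _); last by rewrite -mulrA.
by rewrite minEle; case: ifP => _; [rewrite mulr1|rewrite mulrA].
Qed.

Lemma quad_growth_large_le (X M B : R) y : 0 <= M -> 1 <= B ->
  X <= M * B -> X <= M * B * enorm y ^+ 2 -> X <= M * B * g y.
Proof.
move=> M0 B1 X1 X2; rewrite /quad_growth; case: ifPn => // y1.
rewrite -ltNge in y1; apply: (le_trans X1).
rewrite -[leLHS]mulr1 ler_wpM2l ?mulr_ge0 ?(le_trans _ B1)//.
apply: (@le_trans _ _ (1 `^ alpha)); first by rewrite powR1.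
by apply: ler_powRl => //; exact: ltW.
Qed.

Let solu_le x (c : R) : 0 <= c -> (forall y, D x y <= c * g y) ->
  lambda * u x - u x `^ p <= c * J.
Proof. by move=> c0 h; have := fraclap_le N2 al0 al1 c0 h; rewrite solu lee_fin. Qed.

Let solu_ge x (c : R) : 0 <= c -> (forall y, - D x y <= c * g y) ->
  - (c * J) <= lambda * u x - u x `^ p.
Proof. by move=> c0 h; have := fraclap_ge N2 al0 al1 c0 h; rewrite solu lee_fin. Qed.

Let u_powE x : u x `^ p = u x * u x `^ (p - 1).
Proof. by rewrite mulr_powRB1//; move: p1; lra. Qed.

Lemma enorm_le_coord (del : R) x : (forall i, `|x ord0 i| <= del) ->
  enorm x <= N%:R * del.
Proof.
move=> h; have d0 : 0 <= del.
  by apply: le_trans (h (Ordinal (ltnW N2))); exact: normr_ge0.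
rewrite -ler_sqr ?nnegrE ?enorm_ge0 ?mulr_ge0// sqr_enorm.
apply: (@le_trans _ _ (\sum_(i < N) del ^+ 2)).
  apply: ler_sum => i _; rewrite -real_normK ?num_real//.
  by rewrite ler_sqr ?nnegrE.
rewrite sumr_const card_ord -[leLHS]mulr_natl exprMn ler_wpM2r ?sqr_ge0//.
by rewrite expr2 ler_peMl// ler1n ltnW.
Qed.

Lemma positive_mass z0 : 0 < u z0 -> exists m del : R,
  [/\ 0 < m, 0 < del & forall z, (forall i, `|z ord0 i - z0 ord0 i| <= del) -> m <= u z].
Proof.
move=> uz0; have h : 0 < u z0 / 2 by rewrite divr_gt0.
have /cvgrPdist_lt/(_ _ h) := @cu z0 => /nbhs_ballP[e /= e0 he].
exists (u z0 / 2), (e / 2); split => //; first by rewrite divr_gt0.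
move=> z hz; have : `|u z0 - u z| < u z0 / 2.
  apply: he; split=> // i j; rewrite (ord1 i) /ball /= distrC.
  by apply: le_lt_trans (hz j) _; lra.
by rewrite ltr_norml => /andP[_]; lra.
Qed.

(** Strong maximum principle: at a zero of [u] the right-hand side vanishes, all second differences
    are nonpositive, and the mass near [z0] makes the integral strictly negative. *)
Lemma solution_gt0 z0 : 0 < u z0 -> forall x, 0 < u x.
Proof.
move=> uz0 x; rewrite lt_neqAle u0 andbT eq_sym; apply/eqP => ux0.
have [m [del [m0 d0 hm]]] := positive_mass uz0.
(* Bounds [|y|] on the cube of radius [del] about [z0 - x]. *)
pose rho := enorm (z0 - x) + N%:R * del + 1.
have rho0 : 0 < rho.
  by rewrite ltr_wpDl// addr_ge0 ?enorm_ge0// mulr_ge0// ltW.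
have := @fraclap_le_mass _ _ _ u N2 al0 al1 x 0 m del rho z0 (lexx _) m0 d0 rho0.
rewrite solu ux0 mulr0 powR0 ?subr0 ?mul0r ?sub0r; last by move: p1; lra.
rewrite lee_fin => h.
have : 0 <= - (m / rho `^ q * (2 * del) ^+ N).
  apply: h => y.
    by rewrite /second_diff ux0 mul0r; have := u0 (x + y); have := u0 (x - y); lra.
  move=> hy; split.
    rewrite /second_diff ux0; have := u0 (x - y); have : m <= u (x + y).
      apply: hm => i; have := hy i; rewrite !mxE.
      by rewrite (_ : y ord0 i - (z0 ord0 i - x ord0 i) = x ord0 i + y ord0 i - z0 ord0 i)//; ring.
    by lra.
  have -> : y = (z0 - x) + (y - (z0 - x)) by rewrite addrC subrK.
  apply: le_trans (enormD_le _ _) _; rewrite /rho.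
  have : enorm (y - (z0 - x)) <= N%:R * del.
    by apply: enorm_le_coord => i; have := hy i; rewrite !mxE.
  by lra.
have : 0 < m / rho `^ q * (2 * del) ^+ N.
  by rewrite mulr_gt0 ?divr_gt0 ?powR_gt0 ?exprn_gt0 ?mulr_gt0.
by lra.
Qed.

(** If [k > K >= 1], then [k^(p-1) >= a + c + 1] and [k^p >= a k + c k + k > a k + c]. *)
Lemma le_of_pow_le (a c : R) : 0 <= a -> 0 <= c -> exists K : R,
  forall k : R, 0 <= k -> k `^ p <= a * k + c -> k <= K.
Proof.
move=> a0 c0; have pm : 0 < p - 1 by move: p1; lra.
pose K := (a + c + 1) `^ (p - 1)^-1; exists K => k k0 kp.
have Kp : K `^ (p - 1) = a + c + 1.
  by rewrite /K -powRrM mulVf ?gt_eqF// powRr1// addr_ge0// addr_ge0.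
have K1 : 1 <= K.
  rewrite -[leLHS](powRr0 (a + c + 1)) /K; apply: ler_powR; first lra.
  by rewrite invr_ge0 ltW.
rewrite leNgt; apply/negP => Kk.
have kpE : k `^ p = k * k `^ (p - 1) by rewrite mulr_powRB1//; move: p1; lra.
have : K `^ (p - 1) <= k `^ (p - 1).
  by apply: ler_powRl; [exact: ltW|exact: le_trans K1|exact: ltW].
by rewrite Kp; move: (k `^ (p - 1)) kpE kp => t -> kp ht; nra.
Qed.

(** * Upper bound for bounded solutions *)

Lemma bounded_pow_le (K : R) : (forall x, u x <= K) -> forall x, u x `^ (p - 1) <= lambda.
Proof.
move=> uK z; rewrite leNgt; apply/negP => uz.
have pm : 0 < p - 1 by move: p1; lra.
pose M := lambda `^ (p - 1)^-1.
have M0 : 0 < M by rewrite powR_gt0.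
have Mp : M `^ (p - 1) = lambda by rewrite /M -powRrM mulVf ?gt_eqF// powRr1// ltW.
have powlt v w : 0 <= v -> v < w -> v `^ (p - 1) < w `^ (p - 1).
  move=> v0 vw; apply: gt0_ltr_powR => //; rewrite nnegrE//.
  exact: ltW (le_lt_trans v0 vw).
have Mz : M < u z.
  rewrite ltNge; apply/negP => h; have : u z `^ (p - 1) <= M `^ (p - 1).
    by apply: ler_powRl => //; exact: ltW.
  by rewrite Mp leNgt uz.
(* A level strictly between [M] and [u z]: wherever [u >= m], the reaction term is at most
   [- c < 0]. *)
pose m := (M + u z) / 2.
have Mm : M < m by rewrite /m; lra.
have mz : m < u z by rewrite /m; lra.
pose c := m * (m `^ (p - 1) - lambda).
have c0 : 0 < c.
  by rewrite mulr_gt0 ?subr_gt0 -?Mp; [|exact: lt_trans Mm|exact: powlt (ltW M0) Mm].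
(* The second condition keeps [u x1 >= m] at the maximum point below; the third contradicts the
   equation there. *)
have [eps [e0 ez eJ]] : exists eps : R, [/\ 0 < eps, eps <= u z - m & 4 * eps * J < c].
  have d0 : 0 < 4 * J + 1 by move: J0; lra.
  exists (Num.min (u z - m) (c / (4 * J + 1))); split.
  - by rewrite lt_min subr_gt0 mz divr_gt0.
  - by rewrite ge_min lexx.
  have : Num.min (u z - m) (c / (4 * J + 1)) <= c / (4 * J + 1) by rewrite ge_min lexx orbT.
  rewrite ler_pdivlMr//.
  set e := Num.min _ _ => h.
  have : 0 < e by rewrite lt_min subr_gt0 mz divr_gt0.
  by move: h J0; nra.
pose S := sup (range u).
have hS : has_sup (range u).
  by split; [exists (u z); exists z|exists K => _ [y _ <-]].
have uS y : u y <= S by apply: sup_upper_bound => //; exists y.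
have [_ [x0 _ <-] x0S] := sup_adherent e0 hS; rewrite -/S in x0S.
pose psi := cap x0 1.
(* The cap lifts [u x0] by [2 eps], more than its deficit [eps] from the supremum, so the maximum is
   positive and lies inside the unit ball about [x0]; outside, [f] is 0. *)
pose f x := Num.max 0 (u x + 2 * eps * psi x - S).
have cf : continuous f.
  move=> x; have c1 : {for x, continuous (fun w => u w + 2 * eps * psi w - S)}.
    apply: continuousB; last exact: cst_continuous.
    apply: continuousD; first exact: cu.
    apply: continuousM; first exact: cst_continuous.
    exact: continuous_cap.
  apply: (@continuous_max R 'rV[R]_N (fun=> 0) _ x _ c1).
  exact: cst_continuous.
have [||x1 fmax] := global_max (x0 := x0) ltr01 cf.
- by move=> x; rewrite le_max lexx.
- move=> x hx; apply/max_idPl; rewrite /psi cap_outside// mulr0 addr0 subr_le0.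
  exact: uS.
have fx1 : eps < f x1.
  apply: lt_le_trans (fmax x0); rewrite lt_max; apply/orP; right.
  by rewrite /psi cap_center expr1n; lra.
have fx1E : f x1 = u x1 + 2 * eps * psi x1 - S.
  apply/max_idPr; move: fx1; rewrite /f lt_max => /orP[|]; last by move: e0; lra.
  by move: e0; lra.
have psi1 : psi x1 <= 1 by rewrite -[leRHS](expr1n _ 2); exact: cap_le.
have psi0 y : 0 <= psi y by exact: cap_ge0.
have psix1 : 0 < psi x1.
  by rewrite lt_neqAle psi0 andbT; apply/eqP => h; move: fx1 (uS x1); rewrite fx1E -h; lra.
have uf y : u y + 2 * eps * psi y <= u x1 + 2 * eps * psi x1.
  have : u y + 2 * eps * psi y - S <= f x1.
    by apply: le_trans (fmax y); rewrite le_max lexx orbT.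
  by rewrite fx1E; lra.
have mx1 : m <= u x1.
  have : eps * psi x1 <= eps by rewrite ler_piMr// ltW.
  by move: fx1 (uS z); rewrite fx1E; lra.
have Dx1 y : - D x1 y <= 4 * eps * g y.
  have b2 := cap_second_difference y psix1; rewrite -/psi in b2.
  have := uf (x1 + y); have := uf (x1 - y); rewrite /second_diff => h1 h2.
  (* Maximality transfers the second difference of [u] to that of the cap, which is at most 2 and at
     most [2 |y|^2]. *)
  have h3 : - (2 * u x1 - u (x1 + y) - u (x1 - y)) <=
      2 * eps * (2 * psi x1 - psi (x1 + y) - psi (x1 - y)) by nra.
  rewrite -[4 * eps]mulr1; apply: quad_growth_large_le => //.
  - by rewrite mulr_ge0 ?ltW.
  - apply: (le_trans h3); have := psi0 (x1 + y); have := psi0 (x1 - y); nra.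
  - by apply: (le_trans h3); move: (enorm y ^+ 2) b2 => e2 b2; nra.
have e4 : 0 <= 4 * eps by rewrite mulr_ge0 ?ltW.
have := solu_ge e4 Dx1; rewrite u_powE.
have : c <= u x1 * (u x1 `^ (p - 1) - lambda).
  apply: ler_pM => //.
  - by apply: ltW; apply: lt_trans Mm.
  - by rewrite subr_ge0 -Mp ltW// powlt// ltW.
  - rewrite lerD2r; apply: ler_powRl => //; first exact: ltW.
    by apply: ltW; apply: lt_trans Mm.
by lra.
Qed.

(** * Lower bound for positive bounded solutions *)

Lemma touching_below x0 (r : R) n : 0 < r -> (0 < n)%N -> (forall x, 0 < u x) ->
  exists x1, let b := cap x0 r x1 in
  [/\ 0 < b, u x1 * (r ^+ 2) ^+ n <= u x0 * b ^+ n, forall y, D x1 y <= 2 * u x1 &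
      forall y, D x1 y <= 2 * u x1 * (n%:R / b) * enorm y ^+ 2].
Proof.
(* Minimizing [u / psi^n] is done by maximizing the inverse, which is continuous and vanishes
   outside the ball. *)
move=> r0 n0 up; pose psi := cap x0 r; pose f x := psi x ^+ n / u x.
have psi0 x : 0 <= psi x by exact: cap_ge0.
have cf : continuous f.
  move=> x; have c1 : {for x, continuous (fun w => psi w ^+ n)}.
    apply: (@continuous_comp _ _ _ psi (fun s => s ^+ n)).
      exact: continuous_cap.
    exact: exprn_continuous.
  have c2 : {for x, continuous (fun w => (u w)^-1)}.
    by apply: continuousV; [rewrite gt_eqF|exact: cu].
  exact: (continuousM c1 c2).
have [||x1 fmax] := global_max (x0 := x0) r0 cf.
- by move=> x; rewrite divr_ge0 ?exprn_ge0.
- by move=> x hx; rewrite /f /psi (cap_outside (ltW r0) hx) expr0n gt_eqF// mul0r.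
have uf x : u x1 * psi x ^+ n <= u x * psi x1 ^+ n.
  have := fmax x; rewrite /f ler_pdivrMr// mulrAC ler_pdivlMr// mulrC.
  by rewrite [u x * _]mulrC.
have b0 : 0 < psi x1.
  have := uf x0; rewrite /psi cap_center -/psi => h.
  have : 0 < u x0 * psi x1 ^+ n.
    by apply: lt_le_trans h; rewrite mulr_gt0 ?exprn_gt0.
  rewrite pmulr_rgt0// lt_neqAle eq_sym expf_eq0 n0 /= => /andP[h2 _].
  by rewrite lt_neqAle eq_sym h2 psi0.
exists x1; rewrite -/psi; split=> //.
- by have := uf x0; rewrite {1}/psi cap_center.
- by move=> y; rewrite /second_diff; have := u0 (x1 + y); have := u0 (x1 - y); lra.
move=> y.
(* Bernoulli replaces the power by an affine expression in the cap, to which [cap_second_difference]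
   applies. *)
have lower z : u x1 * (1 + n%:R * (psi z / psi x1 - 1)) <= u z.
  apply: (@le_trans _ _ (u x1 * (psi z / psi x1) ^+ n)).
    by rewrite ler_pM2l// bernoulli_le// divr_ge0.
  by rewrite expr_div_n mulrA ler_pdivrMr ?exprn_gt0//; exact: uf.
have := lower (x1 + y); have := lower (x1 - y).
have := cap_second_difference y b0; rewrite -/psi => h2 l1 l2.
have h3 : 2 - 2 * (enorm y ^+ 2 / psi x1) <= psi (x1 + y) / psi x1 + psi (x1 - y) / psi x1.
  by rewrite -mulrDl ler_pdivlMr// mulrBl -mulrA divfK ?gt_eqF// mulrC [X in X - _]mulrC.
have h4 : u x1 * n%:R * (2 - 2 * (enorm y ^+ 2 / psi x1)) <=
    u x1 * n%:R * (psi (x1 + y) / psi x1 + psi (x1 - y) / psi x1).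
  by rewrite ler_wpM2l// mulr_ge0.
have -> : 2 * u x1 * (n%:R / psi x1) * enorm y ^+ 2 =
  2 * (u x1 * n%:R * (enorm y ^+ 2 / psi x1)) by ring.
rewrite /second_diff; move: l1 l2 h4.
by move: (psi (x1 + y) / psi x1) (psi (x1 - y) / psi x1) (enorm y ^+ 2 / psi x1) => A B C; lra.
Qed.

Lemma solution_pow_ge (K : R) x0 (eps : R) : (forall x, u x <= K) ->
  (forall x, 0 < u x) -> 0 < eps -> lambda - eps <= u x0 `^ (p - 1).
Proof.
move=> uK up e0; have pm : 0 < p - 1 by move: p1; lra.
have [m [del [m0 d0 hm]]] := positive_mass (up x0).
(* Large enough for [r^q <= r^n], since [2 alpha < 2]. *)
pose n := N.+2.
have nR0 : 0 < n%:R :> R by rewrite ltr0n.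
have qn : q <= n%:R by rewrite /n -[N.+2]addn2 natrD lerD2l; move: al1; lra.
have K0 : 0 < K by exact: lt_le_trans (up x0) (uK x0).
have [t [t0 t1 tJ]] : exists t : R, [/\ 0 < t, t <= 1 & 2 * t `^ (alpha / 2) * J <= eps].
  have dJ : 0 < 2 * J + 1 by move: J0; lra.
  pose s := Num.min 1 (eps / (2 * J + 1)).
  have s0 : 0 < s by rewrite lt_min ltr01 divr_gt0.
  have sJ : s * (2 * J + 1) <= eps by rewrite -ler_pdivlMr// ge_min lexx orbT.
  exists (s `^ (2 / alpha)); split; first exact: powR_gt0.
    apply: (@le_trans _ _ (1 `^ (2 / alpha))); last by rewrite powR1.
    apply: ler_powRl; [by rewrite divr_ge0// ltW|exact: ltW|by rewrite ge_min lexx].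
  rewrite -powRrM (_ : 2 / alpha * (alpha / 2) = 1); last first.
    by field; rewrite gt_eqF.
  by rewrite powRr1 ?ltW//; move: sJ s0; nra.
(* Threshold for the cap value [b]: if [b >= A] then [n / b <= t], and the choice of [t] makes the
   error at most [eps * u1]. *)
pose A := n%:R / t.
have A0 : 0 < A by rewrite divr_gt0.
have nA : n%:R <= A by rewrite ler_pdivlMr// ler_piMr// ltW.
(* When [b < A], [C * u1 / b] collects the touching error and the term [u1^p], while [k0 / r^q] is
   the contribution of the mass near [x0]. *)
pose C := 2 * A * J + K `^ (p - 1) * A.
have C0 : 0 <= C.
  apply: addr_ge0; last exact: mulr_ge0 (powR_ge0 _ _) (ltW A0).
  by apply: mulr_ge0 => //; apply: mulr_ge0 => //; exact: ltW.
pose k0 := m / 2 * (2 * del) ^+ N / 2 `^ q.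
have k00 : 0 < k0.
  rewrite divr_gt0 ?powR_gt0//; apply: mulr_gt0; first exact: divr_gt0.
  by rewrite exprn_gt0// mulr_gt0.
have Nd0 : 0 <= N%:R * del by rewrite mulr_ge0// ltW.
(* The third condition keeps [|y| <= 2 r] on the mass cube; the last two exclude, for [b < A], the
   cases [u1 >= m / 4] and [u1 < m / 4]. *)
have [r [r1 Ar dr mr kr]] : exists r : R, [/\ 1 <= r, A <= r, N%:R * del <= r,
    4 * K < r * m & C * K * A ^+ N.+1 < r * k0].
  have h1 : 0 <= 4 * K / m by apply: ltW; rewrite divr_gt0// mulr_gt0.
  have h2 : 0 <= C * K * A ^+ N.+1 / k0.
    apply: divr_ge0 (ltW k00); apply: mulr_ge0 (exprn_ge0 _ (ltW A0)).
    exact: mulr_ge0 C0 (ltW K0).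
  have hX w : (4 * K / m < w) = (4 * K < w * m) by exact: ltr_pdivrMr.
  have hY w : (C * K * A ^+ N.+1 / k0 < w) = (C * K * A ^+ N.+1 < w * k0).
    exact: ltr_pdivrMr.
  move: (4 * K / m) (C * K * A ^+ N.+1 / k0) h1 h2 hX hY => X Y X0 Y0 hX hY.
  exists (1 + A + N%:R * del + X + Y).
  by split; rewrite -?hX -?hY; move: (N%:R * del) Nd0 X0 Y0 A0 => Z; lra.
have r0 : 0 < r by lra.
have rn : r <= r ^+ n by exact: ler_eXnr.
have rn0 : 0 < r ^+ n by rewrite exprn_gt0.
have [|x1 /=] := @touching_below x0 r n r0 _ up; first by [].
set b := cap x0 r x1; set u1 := u x1 => -[b0 ub D1 D2].
have u10 : 0 < u1 by exact: up.
have rr : (r ^+ 2) ^+ n = r ^+ n * r ^+ n by rewrite -exprM mulnC exprM expr2.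
have u1u : u1 <= u x0.
  have : u x0 * b ^+ n <= u x0 * (r ^+ 2) ^+ n.
    rewrite ler_pM2l//; apply: lerXn2r; rewrite ?nnegrE ?sqr_ge0 ?(ltW b0)//.
    exact: cap_le.
  by move/(le_trans ub); rewrite ler_pM2r// exprn_gt0// exprn_gt0.
have [Ab|bA] := lerP A b.
  have Bt : n%:R / b <= t.
    rewrite ler_pdivrMr//; apply: (@le_trans _ _ (t * A)).
      by rewrite /A mulrC divfK ?gt_eqF.
    by rewrite ler_pM2l.
  have B01 : 0 < n%:R / b <= 1 by rewrite divr_gt0//= (le_trans Bt).
  have u12 : 0 <= 2 * u1 by rewrite mulr_ge0// ltW.
  have Dg y : D x1 y <= 2 * u1 * (n%:R / b) `^ (alpha / 2) * g y.
    exact: quad_growth_scaled_le.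
  have := solu_le (mulr_ge0 u12 (powR_ge0 _ _)) Dg; rewrite -/u1 => h.
  have hB : (n%:R / b) `^ (alpha / 2) <= t `^ (alpha / 2).
    apply: ler_powRl => //; first by rewrite divr_ge0// ltW.
    by rewrite divr_ge0// ltW.
  have h2 : 2 * u1 * (n%:R / b) `^ (alpha / 2) * J <= u1 * eps.
    rewrite -[2 * u1]mulrC -!mulrA ler_pM2l// mulrA (le_trans _ tJ)//.
    by rewrite ler_wpM2r// ler_pM2l.
  have : lambda - u1 `^ (p - 1) <= eps.
    rewrite -(ler_pM2l u10) mulrBr -u_powE mulrC.
    exact: le_trans h h2.
  have : u1 `^ (p - 1) <= u x0 `^ (p - 1) by apply: ler_powRl => //; exact: ltW.
  by lra.
exfalso.
have uKA : u1 * (r ^+ n * r ^+ n) <= K * b ^+ n.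
  by rewrite -rr (le_trans ub)// ler_pM2r ?exprn_gt0.
(* If [u1 >= m / 4], touching and [b <= r] give [u1 r^n <= K], contradicting [4 K < r m]. Otherwise
   the second difference is below [- m / 2] on the mass cube. *)
have [mu1|u1m] := lerP (m / 4) u1.
  have h1 : K * b ^+ n <= K * r ^+ n.
    rewrite ler_pM2l//; apply: lerXn2r; rewrite ?nnegrE ?ltW//.
    exact: lt_le_trans Ar.
  have := le_trans uKA h1; rewrite mulrA ler_pM2r// => h2.
  have : m / 4 * r <= u1 * r ^+ n by apply: ler_pM => //; rewrite ?divr_ge0 ?ltW.
  by lra.
have AB1 : 1 <= A / b by rewrite ler_pdivlMr// mul1r ltW.
have u12 : 0 <= 2 * u1 by rewrite mulr_ge0// ltW.
have Dg y : D x1 y <= 2 * u1 * (A / b) * g y.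
  apply: quad_growth_large_le => //.
    by apply: (le_trans (D1 y)); rewrite ler_peMr.
  apply: (le_trans (D2 y)); rewrite ler_wpM2r ?sqr_ge0// ler_wpM2l//.
  by rewrite ler_pM2r ?invr_gt0.
have c0 : 0 <= 2 * u1 * (A / b) by rewrite mulr_ge0// (le_trans _ AB1).
have m20 : 0 < m / 2 by rewrite divr_gt0.
have r20 : 0 < 2 * r by rewrite mulr_gt0.
have := @fraclap_le_mass _ _ _ u N2 al0 al1 x1 _ (m / 2) del (2 * r) x0 c0 m20 d0 r20 Dg.
rewrite solu lee_fin -/u1 => h.
have {}h : lambda * u1 - u1 `^ p <=
    2 * u1 * (A / b) * J - m / 2 / (2 * r) `^ q * (2 * del) ^+ N.
  apply: h => y hy; split.
    have := u0 (x1 - y); have : m <= u (x1 + y).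
      apply: hm => i; have := hy i; rewrite !mxE.
      rewrite (_ : y ord0 i - _ = x1 ord0 i + y ord0 i - x0 ord0 i)//.
      by ring.
    by rewrite /second_diff -/u1; lra.
  have -> : y = (x0 - x1) + (y - (x0 - x1)) by rewrite addrC subrK.
  apply: le_trans (enormD_le _ _) _.
  have : enorm (y - (x0 - x1)) <= N%:R * del.
    by apply: enorm_le_coord => i; have := hy i; rewrite !mxE.
  have : enorm (x0 - x1) <= r.
    by rewrite -enormN opprB; exact: cap_gt0_enorm (ltW r0) b0.
  by lra.
have kE : m / 2 / (2 * r) `^ q * (2 * del) ^+ N = k0 / r `^ q.
  rewrite /k0 powRM ?ltW//; field.
  by rewrite !gt_eqF// powR_gt0.
rewrite kE in h.
have rq : r `^ q <= r ^+ n by rewrite -powR_mulrn ?(ltW r0)//; exact: ler_powR.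
have k1 : k0 / r ^+ n <= k0 / r `^ q.
  by rewrite ler_pM2l// lef_pV2 ?posrE ?powR_gt0.
have uKp : u1 `^ p <= u1 * (K `^ (p - 1) * (A / b)).
  rewrite u_powE ler_pM2l//; apply: (@le_trans _ _ (K `^ (p - 1))).
    by apply: ler_powRl; [exact: ltW|exact: ltW|exact: uK].
  by rewrite ler_peMr// powR_ge0.
have h2 : k0 / r ^+ n <= u1 * C / b.
  have -> : u1 * C / b = 2 * u1 * (A / b) * J + u1 * (K `^ (p - 1) * (A / b)).
    by rewrite /C; ring.
  have : 0 <= lambda * u1 by rewrite mulr_ge0// ltW.
  by lra.
(* The mass inequality is combined with [u1 r^(2n) <= K b^n]. Cancelling one factor [b] leaves the
   exponent [N + 1] on the right, where [b < A], against [r^n >= r] on the left. *)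
have h3 : k0 * b * r ^+ n <= C * K * b ^+ n.
  have : k0 * b <= u1 * C * r ^+ n.
    rewrite ler_pdivrMr// in h2; apply: le_trans (_ : (u1 * C / b * r ^+ n) * b <= _).
      by rewrite ler_pM2r.
    by rewrite mulrAC divfK ?gt_eqF.
  rewrite -(ler_pM2r rn0) => /le_trans; apply.
  have -> : u1 * C * r ^+ n * r ^+ n = C * (u1 * (r ^+ n * r ^+ n)) by ring.
  by rewrite -mulrA ler_wpM2l.
have h4 : k0 * r ^+ n <= C * K * b ^+ N.+1.
  have E : C * K * b ^+ N.+1 * b = C * K * b ^+ n by rewrite /n [in RHS]exprSr mulrA.
  by rewrite -(ler_pM2r b0) E mulrAC.
have h5 : C * K * b ^+ N.+1 <= C * K * A ^+ N.+1.
  rewrite ler_wpM2l ?mulr_ge0 ?(ltW K0)//; apply: lerXn2r; rewrite ?nnegrE ?ltW//.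
have : r * k0 <= k0 * r ^+ n by rewrite mulrC ler_pM2l.
by lra.
Qed.

(** * Boundedness of solutions *)

Lemma touching_above x0 (r : R) n : 0 < r -> (0 < n)%N -> 0 < u x0 ->
  exists x1, let b := cap x0 r x1 in
  [/\ 0 < b, u x0 * (r ^+ 2) ^+ n <= u x1 * b ^+ n &
      forall z, u z * cap x0 r z ^+ n <= u x1 * b ^+ n].
Proof.
move=> r0 n0 ux0; pose psi := cap x0 r; pose f x := u x * psi x ^+ n.
have psi0 x : 0 <= psi x by exact: cap_ge0.
have cf : continuous f.
  move=> x; have c1 : {for x, continuous (fun w => psi w ^+ n)}.
    apply: (@continuous_comp _ _ _ psi (fun s => s ^+ n)).
      exact: continuous_cap.
    exact: exprn_continuous.
  exact: (continuousM (@cu x) c1).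
have [||x1 fmax] := global_max (x0 := x0) r0 cf.
- by move=> x; rewrite mulr_ge0 ?exprn_ge0.
- by move=> x hx; rewrite /f /psi (cap_outside (ltW r0) hx) expr0n gt_eqF// mulr0.
have fx0 : u x0 * (r ^+ 2) ^+ n <= f x1.
  by have := fmax x0; rewrite {1}/f /psi cap_center.
exists x1; rewrite -/psi; split; [|exact: fx0|exact: fmax].
have : 0 < f x1 by apply: lt_le_trans fx0; rewrite mulr_gt0// exprn_gt0// exprn_gt0.
rewrite lt_neqAle eq_sym mulf_eq0 negb_or expf_eq0 n0 /= => /andP[/andP[_ h] _].
by rewrite lt_neqAle eq_sym h psi0.
Qed.

(** Maximality and Bernoulli give [u (x1 + z) (1 - s) <= u x1] with [s] small for near [z]; then
    [1 / (1 - s)] is expanded to second order, and the part of [s] linear in [z] cancels between [y]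
    and [- y]. *)
Lemma touching_above_near x0 (r : R) n x1 y : 0 < r -> (0 < n)%N ->
  let b := cap x0 r x1 in let e := enorm y in 0 < b ->
  (forall z, u z * cap x0 r z ^+ n <= u x1 * b ^+ n) -> 6 * n%:R * r * e <= b ->
  - D x1 y <= u x1 * 2 /\
  - D x1 y <= u x1 * ((2 * n%:R / b + 36 * n%:R ^+ 2 * r ^+ 2 / b ^+ 2) * e ^+ 2).
Proof.
move=> r0 n0 b e b0 umax eb.
have e0 : 0 <= e by exact: enorm_ge0.
have n1 : 1 <= n%:R :> R by rewrite ler1n.
have br : b <= r ^+ 2 by exact: cap_le.
have er : e <= r.
  rewrite -(ler_pM2l r0) -expr2; apply: le_trans br; apply: le_trans eb.
  have -> : 6 * n%:R * r * e = (6 * n%:R) * (r * e) by ring.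
  by apply: ler_peMl; [exact: mulr_ge0 (ltW r0) e0|lra].
(* A bound for [|s|]; the nearness condition is exactly [h <= 1/2]. *)
pose h := 3 * n%:R * r * e / b.
have h2 : h <= 1 / 2 by rewrite /h ler_pdivrMr//; move: eb; lra.
have step z : enorm z = e ->
    u (x1 + z) <= u x1 * (1 + n%:R * (e ^+ 2 + 2 * dot (x1 - x0) z) / b + 2 * h ^+ 2).
  move=> ze; set d := e ^+ 2 + 2 * dot (x1 - x0) z.
  have dle : `|d| <= 3 * r * e.
    have := norm_dot_le (x1 - x0) z; rewrite ze => h1.
    have h3 : enorm (x1 - x0) * e <= r * e.
      by apply: ler_wpM2r => //; exact: cap_gt0_enorm (ltW r0) b0.
    apply: le_trans (ler_normD _ _) _.
    rewrite (ger0_norm (sqr_ge0 e)) normrM (ger0_norm (ler0n _ 2)).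
    have : e ^+ 2 <= r * e by rewrite expr2; apply: ler_wpM2r.
    by lra.
  have dh : n%:R * `|d| / b <= h.
    rewrite /h ler_pM2r ?invr_gt0//.
    have -> : 3 * n%:R * r * e = n%:R * (3 * r * e) by ring.
    by rewrite ler_pM2l// (lt_le_trans ltr01).
  pose w := 1 - d / b.
  have dbh : `|d / b| <= 1 / 2.
    rewrite normrM [X in _ * X]gtr0_norm ?invr_gt0//.
    apply: le_trans h2; apply: le_trans dh.
    by rewrite -mulrA ler_peMl// mulr_ge0// invr_ge0 ltW.
  have w0 : 0 <= w by rewrite /w; move: dbh; rewrite ler_norml => /andP[]; lra.
  have wcap : b * w <= cap x0 r (x1 + z).
    have := cap_shift_ge z b0; rewrite -/b ze.
    have -> : b * w = b - e ^+ 2 - 2 * dot (x1 - x0) z.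
      by rewrite /w /d; field; rewrite gt_eqF.
    by [].
  have uw : u (x1 + z) * w ^+ n <= u x1.
    rewrite -(ler_pM2r (exprn_gt0 n b0)); apply: le_trans (umax (x1 + z)).
    rewrite -mulrA -exprMn mulrC [w * b]mulrC [leRHS]mulrC ler_wpM2r//.
    by apply: lerXn2r; rewrite ?nnegrE ?cap_ge0 ?mulr_ge0 ?(ltW b0).
  pose s := n%:R * d / b.
  have sh : `|s| <= h by rewrite /s !normrM ger0_norm// [X in _ * X]gtr0_norm ?invr_gt0.
  have us : u (x1 + z) * (1 - s) <= u x1.
    apply: le_trans uw; apply: ler_wpM2l => //.
    apply: le_trans (bernoulli_le n w0).
    by rewrite /w /s le_eqVlt; apply/orP; left; apply/eqP; ring.
  have sh2 : s ^+ 2 <= h ^+ 2.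
    rewrite -real_normK ?num_real//; apply: lerXn2r; rewrite ?nnegrE//.
    exact: le_trans sh.
  rewrite -/s; move: sh; rewrite ler_norml => /andP[s1 s2].
  have s3 : 0 < 1 - s by lra.
  rewrite -(ler_pM2r s3); apply: (le_trans us).
  rewrite -mulrA; apply: ler_peMr => //.
  (* With the next inequality this yields [(1 + s + 2 h^2)(1 - s) >= 1]. *)
  have s4 : 0 <= s ^+ 2 * (1 - 2 * s) by rewrite mulr_ge0 ?sqr_ge0//; lra.
  have s5 : 0 <= (h ^+ 2 - s ^+ 2) * (1 - s) by apply: mulr_ge0; [rewrite subr_ge0|exact: ltW].
  by nra.
have := step (- y) (enormN y); have := step y erefl; rewrite dotNr => l1 l2.
have L : - D x1 y <= u x1 * (2 * n%:R / b * e ^+ 2 + 4 * h ^+ 2).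
  have -> : u x1 * (2 * n%:R / b * e ^+ 2 + 4 * h ^+ 2) =
    u x1 * (1 + n%:R * (e ^+ 2 + 2 * dot (x1 - x0) y) / b + 2 * h ^+ 2) +
    u x1 * (1 + n%:R * (e ^+ 2 + 2 * - dot (x1 - x0) y) / b + 2 * h ^+ 2) - 2 * u x1 by ring.
  by rewrite /second_diff; lra.
have h0 : 0 <= h.
  by rewrite /h divr_ge0 ?(ltW b0)// !mulr_ge0// ltW.
split; last first.
  apply: (le_trans L); apply: ler_wpM2l => //.
  rewrite le_eqVlt; apply/orP; left; apply/eqP.
  by rewrite /h; field; rewrite gt_eqF.
apply: (le_trans L); apply: ler_wpM2l => //.
have : 2 * n%:R / b * e ^+ 2 <= h.
  have -> : 2 * n%:R / b * e ^+ 2 = n%:R * e / b * (2 * e) by ring.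
  have -> : h = n%:R * e / b * (3 * r) by rewrite /h; ring.
  apply: ler_wpM2l; last by lra.
  by rewrite divr_ge0 ?(ltW b0)// mulr_ge0.
have : h ^+ 2 <= 1 / 4.
  have : 0 <= (1 / 2 - h) * (1 / 2 + h) by rewrite mulr_ge0//; lra.
  by nra.
by lra.
Qed.

(** Both 1 and [|z|] are at most [3 rho e]. This trades the kernel power at a far [y] for the weight
    [omega] at [x1 + y] or [x1 - y]. *)
Lemma omega_inv_le (r rho e : R) z : 1 <= rho -> 1 <= r -> r <= rho * e ->
  enorm z <= 2 * r + e -> 1 + enorm z `^ q <= 2 * (3 * rho) `^ q * e `^ q.
Proof.
move=> rho1 r1 re ze.
have q0 : 0 <= q by rewrite addr_ge0// mulr_ge0// ltW.
have rho0 : 0 < rho by lra.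
have e0 : 0 <= e by rewrite -(pmulr_rge0 _ rho0); lra.
have ere : e <= rho * e by rewrite ler_peMl.
have z3 : enorm z <= 3 * rho * e by rewrite -mulrA; lra.
have b1 : 1 <= 3 * rho * e by rewrite -mulrA; lra.
have h1 : enorm z `^ q <= (3 * rho * e) `^ q.
  by apply: ler_powRl => //; exact: enorm_ge0.
have h2 : 1 <= (3 * rho * e) `^ q.
  apply: (@le_trans _ _ (1 `^ q)); first by rewrite powR1.
  exact: ler_powRl.
rewrite -mulrA -powRM ?mulr_ge0//; last exact: ltW.
by lra.
Qed.

Lemma solution_bounded : L1_omega alpha u -> exists K : R, forall x, u x <= K.
Proof.
move=> L1; have pm : 0 < p - 1 by move: p1; lra.
(* Ensures [q <= n] and [n (p - 1) >= 2], so that the factor [s^(np)] absorbs both [s^-q] and, up to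
   [s^n], [s^-2]. *)
pose n := (N + 2 + Num.bound (2 / (p - 1)))%N.
have n0 : (0 < n)%N by rewrite /n addn2.
have nR1 : 1 <= n%:R :> R by rewrite ler1n.
have q0 : 0 < q by rewrite ltr_wpDl// mulr_gt0.
have qn : q <= n%:R.
  rewrite /n !natrD; have : 0 <= (Num.bound (2 / (p - 1)))%:R :> R by [].
  by move: al1; lra.
have n2 : 2 <= n%:R * (p - 1).
  rewrite -ler_pdivrMr//; have h : 0 <= 2 / (p - 1) by rewrite divr_ge0// ltW.
  apply: ltW; apply: lt_le_trans (archi_boundP h) _.
  by rewrite /n natrD lerDr.
pose L := L1_norm alpha u.
have L0 : 0 <= L.
  by apply/fine_ge0/intRN_nng_ge0 => y; rewrite lee_fin.
pose C1 : R := 2 * n%:R + 36 * n%:R ^+ 2.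
have C10 : 38 <= C1 by rewrite /C1; nra.
pose C2 := 4 * (18 * n%:R) `^ q * L.
have C20 : 0 <= C2 by rewrite /C2 !mulr_ge0// powR_ge0.
have a0 : 0 <= lambda + C1 * J.
  by apply: addr_ge0; [exact: ltW|apply: mulr_ge0 => //; lra].
have [K hK] := le_of_pow_le a0 C20; exists K => x0.
have := u0 x0; rewrite le_eqVlt => /predU1P[<-|ux0].
  apply: hK => //; rewrite mulr0 add0r powR0//; move: p1; lra.
(* With this radius the touching point satisfies [|x1| <= 2 r - 1], which makes all constants
   independent of [x0]. *)
pose r := 1 + enorm x0.
have r1 : 1 <= r by rewrite lerDl enorm_ge0.
have r0 : 0 < r by lra.
have rr0 : 0 < r ^+ 2 by rewrite exprn_gt0.
have [x1 /=] := touching_above r0 n0 ux0; set b := cap x0 r x1 => -[b0 ux umax].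
have near := @touching_above_near x0 r n x1 _ r0 n0 b0 umax.
have br : b <= r ^+ 2 by exact: cap_le.
pose s := b / r ^+ 2.
have s0 : 0 < s by rewrite divr_gt0.
have s1 : s <= 1 by rewrite ler_pdivrMr// mul1r.
have bE : b = s * r ^+ 2 by rewrite /s divfK ?gt_eqF.
set u1 := u x1 in ux umax near.
have u10 : 0 <= u1 by exact: u0.
have is1 : 1 <= s^-1 by rewrite invf_ge1.
have ir1 : r^-1 <= 1 by rewrite invf_le1.
have ir0 : 0 < r^-1 by rewrite invr_gt0.
have C1s : 2 <= C1 / s ^+ 2.
  rewrite ler_pdivlMr ?exprn_gt0//; have : s ^+ 2 <= 1 by rewrite exprn_ile1// ltW.
  by move: C10; lra.
(* The constant of [omega_inv_le] with [rho = 6 n / s]: failure of the nearness condition means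
   [r < rho |y|]. *)
pose c2 := 2 * (3 * (6 * n%:R / s)) `^ q.
have c20 : 0 <= c2 by rewrite mulr_ge0// powR_ge0.
have c1 : 0 <= u1 * (C1 / s ^+ 2) by apply: mulr_ge0 => //; lra.
pose v z := `|u z| * omega alpha z.
have Dy y : - D x1 y <= u1 * (C1 / s ^+ 2) * g y \/
    (0 < enorm y /\ - D x1 y <= c2 * enorm y `^ q * (v (x1 + y) + v (x1 - y))).
  have [eb|eb] := lerP (6 * n%:R * r * enorm y) b.
    left; have [h1 h2] := near y eb.
    apply: quad_growth_large_le => //; first by lra.
      by apply: (le_trans h1); apply: (ler_wpM2l u10 C1s).
    apply: (le_trans h2); rewrite -[leRHS]mulrA; apply: ler_wpM2l => //.
    apply: ler_wpM2r; first exact: sqr_ge0.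
    have -> : 2 * n%:R / b + 36 * n%:R ^+ 2 * r ^+ 2 / b ^+ 2 =
        2 * n%:R * (s^-1 * (r^-1 * r^-1)) + 36 * n%:R ^+ 2 * (s^-1 * (s^-1 * (r^-1 * r^-1))).
      by rewrite bE; field; rewrite !gt_eqF.
    have -> : C1 / s ^+ 2 = 2 * n%:R * (s^-1 * s^-1) + 36 * n%:R ^+ 2 * (s^-1 * (s^-1 * 1)).
      by rewrite /C1; field; rewrite gt_eqF.
    have i0 : 0 <= s^-1 by lra.
    have rr1 : r^-1 * r^-1 <= 1 by rewrite mulr_ile1// ltW.
    apply: lerD; (apply: ler_wpM2l; first by rewrite !mulr_ge0// exprn_ge0);
      apply: ler_wpM2l => //.
      by apply: le_trans is1; exact: rr1.
    by apply: ler_wpM2l.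
  right; have e0 : 0 < enorm y.
    have : 0 < 6 * n%:R * r * enorm y by exact: lt_trans eb.
    by rewrite pmulr_rgt0// !mulr_gt0// (lt_le_trans ltr01).
  split=> //.
  have re : r <= 6 * n%:R / s * enorm y.
    rewrite mulrAC ler_pdivlMr// -(ler_pM2l r0); apply: ltW.
    by move: eb; rewrite bE; lra.
  have rho1 : 1 <= 6 * n%:R / s by rewrite ler_pdivlMr//; lra.
  have x1r : enorm x1 <= 2 * r - 1.
    have -> : x1 = x0 + (x1 - x0) by rewrite addrC subrK.
    apply: le_trans (enormD_le _ _) _.
    by have := cap_gt0_enorm (ltW r0) b0; rewrite /r; lra.
  have far z : enorm z <= enorm x1 + enorm y -> u z <= c2 * enorm y `^ q * v z.
    move=> hz; have hz2 : enorm z <= 2 * r + enorm y by lra.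
    have w := omega_inv_le rho1 r1 re hz2.
    have w0 : 0 < 1 + enorm z `^ q by rewrite ltr_pwDl ?powR_ge0.
    rewrite /v /omega (ger0_norm (u0 z)).
    have -> : c2 * enorm y `^ q * (u z * (1 / (1 + enorm z `^ q))) =
        c2 * enorm y `^ q / (1 + enorm z `^ q) * u z by ring.
    by apply: ler_peMl => //; rewrite ler_pdivlMr// mul1r.
  rewrite mulrDr /second_diff.
  have h1 := far _ (enormD_le x1 y).
  have h2 := far (x1 - y); rewrite -[in enorm x1 + _](enormN y) in h2.
  have {}h2 := h2 (enormD_le x1 (- y)).
  by move: u10; rewrite /u1; lra.
have := fraclap_ge_L1 N2 al0 al1 L1 c1 c20 Dy.
rewrite solu lee_fin -/u1 -/L => hu.
pose sn := s ^+ n.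
have sn0 : 0 < sn by rewrite exprn_gt0.
have snE t : sn `^ t = s `^ (n%:R * t) by rewrite /sn -powR_mulrn ?ltW// -powRrM.
have s01 : 0 < s <= 1 by rewrite s0.
have snp : sn `^ (p - 1) <= s ^+ 2.
  by rewrite snE -powR_mulrn ?(ltW s0)//; exact: ger_powR.
have s21 : s ^+ 2 <= 1 by rewrite exprn_ile1// ltW.
have snp1 : sn `^ (p - 1) <= 1 by exact: le_trans s21.
have snq : sn `^ p <= s `^ q.
  rewrite snE; apply: ger_powR => //.
  by apply: (le_trans qn); rewrite ler_peMr// ltW.
have xk : u x0 <= u1 * sn.
  rewrite /sn /s expr_div_n mulrA ler_pdivlMr ?exprn_gt0//.
apply: (le_trans xk); apply: hK; first by rewrite mulr_ge0// ltW.
have snpE : sn `^ p = sn * sn `^ (p - 1).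
  by rewrite mulr_powRB1// ?(ltW sn0)//; move: p1; lra.
(* The equation at [x1] is multiplied by [sn^p]; [t1], [t2] and [t3] then bound the terms by a
   multiple of [k = u1 * sn] and a constant. *)
rewrite powRM ?(ltW sn0)//.
have hu2 : u1 `^ p <= lambda * u1 + (u1 * (C1 / s ^+ 2) * J + c2 * (L + L)) by lra.
apply: le_trans (ler_wpM2r (powR_ge0 _ _) hu2) _.
have t1 : lambda * u1 * sn `^ p <= lambda * (u1 * sn).
  have -> : lambda * u1 * sn `^ p = lambda * (u1 * sn) * sn `^ (p - 1).
    by rewrite snpE; ring.
  apply: ler_piMr => //; apply: mulr_ge0; first exact: ltW.
  by rewrite mulr_ge0// ltW.
have t2 : u1 * (C1 / s ^+ 2) * J * sn `^ p <= C1 * J * (u1 * sn).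
  have -> : u1 * (C1 / s ^+ 2) * J * sn `^ p =
      C1 * J * (u1 * sn) * (sn `^ (p - 1) / s ^+ 2) by rewrite snpE; ring.
  apply: ler_piMr; last by rewrite ler_pdivrMr ?exprn_gt0// mul1r.
  apply: mulr_ge0; last by rewrite mulr_ge0// ltW.
  by apply: mulr_ge0 => //; lra.
have t3 : c2 * (L + L) * sn `^ p <= C2.
  have c2E : c2 = 2 * (18 * n%:R) `^ q / s `^ q.
    have sV : s^-1 `^ q = (s `^ q)^-1.
      by rewrite -(powR_inv1 (ltW s0)) -powRrM mulN1r powRN.
    have s18 : (18 * n%:R * s^-1) `^ q = (18 * n%:R) `^ q * s^-1 `^ q.
      by apply: powRM; [exact: mulr_ge0|rewrite invr_ge0 ltW].
    rewrite /c2 (_ : 3 * (6 * n%:R / s) = 18 * n%:R * s^-1); last by ring.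
    by rewrite s18 sV mulrA.
  have -> : c2 * (L + L) * sn `^ p = C2 * (sn `^ p / s `^ q).
    by rewrite c2E /C2; ring.
  by apply: ler_piMr => //; rewrite ler_pdivrMr ?powR_gt0// mul1r.
by lra.
Qed.

(** Either [u] vanishes identically, or it is positive everywhere and the upper and lower bounds
    force [u^(p-1) = lambda]. *)
Lemma solution_constant : L1_omega alpha u -> exists c : R, forall x, u x = c.
Proof.
move=> L1; have [K uK] := solution_bounded L1.
have pm : 0 < p - 1 by move: p1; lra.
have [[z uz]|hz] := pselect (exists z, 0 < u z); last first.
  exists 0 => x; apply/eqP; rewrite eq_le u0 andbT leNgt.
  by apply/negP => h; apply: hz; exists x.
exists (lambda `^ (p - 1)^-1) => x.
have -> : lambda = u x `^ (p - 1).
  apply/eqP; rewrite eq_le (bounded_pow_le uK) andbT.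
  apply/ler_addgt0Pr => e e0; rewrite -lerBlDr.
  exact: (solution_pow_ge x uK (solution_gt0 uz) e0).
by rewrite -powRrM mulfV ?gt_eqF// powRr1.
Qed.

End solutions.

Theorem theorem1p1 (R : realType) (N : nat) (alpha lambda p beta : R)
  (u : 'rV[R]_N -> R) :
  (2 <= N)%N -> 0 < alpha -> alpha < 1 -> 0 < lambda ->
  1 + 2 * alpha < p -> p < (1 + alpha) / (1 - alpha) ->
  0 < beta -> Cloc (2 * alpha + beta) u -> L1_omega alpha u ->
  (forall x, 0 <= u x) ->
  (forall x, integrableRN (fraclap_integrand alpha u x) /\
     intRN (fraclap_integrand alpha u x) = (lambda * u x - u x `^ p)%:E) ->
  exists c : R, forall x, u x = c.
Proof.
move=> N2 al0 al1 la0 pal _ _ [k [gam [_ [_ [_ [cu _]]]]]] L1 u0 solu.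
have p1 : 1 < p by lra.
have {}cu : continuous u by case: k cu => [|k] // [].
exact: (solution_constant N2 al0 al1 la0 p1 cu u0 (fun x => (solu x).2) L1).
Qed.
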